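(* Let $k$ be a field and $A$ a finite-dimensional non-semisimple $k$-algebra. (1) If $A$ is not self-injective, then (TC1) implies $\operatorname{rigdim}(A)<\infty$. (2) If (YC) holds, then $\operatorname{rigdim}(A)<\infty$. Here (TC1) and (YC) are the following (conjectural) assertions. (TC1) (Tachikawa's First Conjecture) For every finite-dimensional $k$-algebra $\Lambda$: if $\operatorname{Ext}^i_\Lambda(\mathrm{D}(\Lambda),\Lambda)=0$ for all $i\geq 1$, then $\Lambda$ is self-injective. (YC) (Yamagata's Conjecture) There exists a function $\varphi:\mathbb{N}\to\mathbb{N}$ such that for every finite-dimensional $k$-algebra $\Lambda$ with finite dominant dimension, $\operatorname{domdim}\Lambda\leq\varphi(n)$, where $n$ is the number of isomorphism classes of simple $\Lambda$-modules.
   Context: All algebras are finite-dimensional associative unital $k$-algebras, all modules are finite-dimensional left modules. $\mathrm{D}=\operatorname{Hom}_k(-,k)$, and $\mathrm{D}(\Lambda)$ means $\mathrm{D}(\Lambda_\Lambda)$ as a left $\Lambda$-module. An $A$-module $M$ is a generator-cogenerator if $A\in\operatorname{add}(M)$ and $\mathrm{D}(A_A)\in\operatorname{add}(M)$, where $\operatorname{add}(M)$ consists of direct summands of finite direct sums of copies of $M$. The dominant dimension $\operatorname{domdim} E$ of an algebra $E$ is the largest $t\in\mathbb{N}_0$, or $\infty$, such that in a minimal injective resolution $0\to {}_EE\to I^0\to I^1\to\cdots$ all $I^i$ with $0\leq i<t$ are projective. The rigidity dimension of $A$ is $$\operatorname{rigdim}(A)=\sup\{\operatorname{domdim}\operatorname{End}_A(M)\mid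 M \text{ a generator-cogenerator in } A\text{-mod},\ \operatorname{gldim}\operatorname{End}_A(M)<\infty\}.$$ $\mathbb{N}$ is the set of positive integers. *)

(* Defs.v *)
From HB Require Import structures.
From mathcomp Require Import all_boot all_order all_algebra all_field.
From mathcomp Require Import boolp.

Set Implicit Arguments.
Unset Strict Implicit.
Unset Printing Implicit Defensive.

Import GRing.Theory.
Local Open Scope ring_scope.

(* Values in N_0 together with infinity.  [esup S] is the supremum of a set S
   of such values (0 if S is empty). *)

Inductive enat := Fin of nat | Inf.

Definition ele (x y : enat) : bool :=
  match x, y with
  | _, Inf => true
  | Inf, Fin _ => false
  | Fin m, Fin n => (m <= n)%N
  end.

Definition efinite (x : enat) : bool := if x is Fin _ then true else false.

Definition eleast (Q : nat -> Prop) : enat :=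
  if pselect (exists n, `[< Q n >]) is left exQ then Fin (ex_minn exQ) else Inf.

Definition esup (S : enat -> Prop) : enat :=
  eleast (fun n => forall x, S x -> ele x (Fin n)).

Lemma eleastP (Q : nat -> Prop) n :
  eleast Q = Fin n <-> Q n /\ forall m, Q m -> (n <= m)%N.
Proof.
rewrite /eleast; case: pselect => [exQ|noQ].
  case: ex_minnP => m /asboolP Qm minm; split.
    by case=> <-; split=> // p Qp; apply: minm; apply/asboolP.
  case=> Qn minn; congr Fin; apply/eqP; rewrite eqn_leq minn // andbT.
  by apply: minm; apply/asboolP.
by split=> // -[Qn _]; case: noQ; exists n; apply/asboolP.
Qed.

Lemma esup_finiteP (S : enat -> Prop) :
  efinite (esup S) <-> exists n, forall x, S x -> ele x (Fin n).
Proof.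
rewrite /esup /eleast; case: pselect => [exQ|noQ] /=; split=> //.
  by case: exQ => n /asboolP Qn; exists n.
by case=> n Qn; case: noQ; exists n; apply/asboolP.
Qed.

(* Finite-dimensional k-algebras are MathComp's [falgType k].  These satisfy
   1 <> 0, which leaves out only the zero algebra; the latter is semisimple and
   self-injective and has infinite dominant dimension. *)

Record fdmod (k : fieldType) (A : falgType k) := FdMod {
  fdcar :> vectType k;
  act : A -> fdcar -> fdcar;
  act_linear : forall a, linear (act a);
  act_linearl : forall x, linear (act^~ x);
  act1 : forall x, act 1 x = x;
  actM : forall a b x, act (a * b) x = act a (act b x)
}.

Arguments act {k A} f _ _.

Definition mod_zero (k : fieldType) (A : falgType k) (M : fdmod A) : Prop :=
  forall x : M, x = 0.

Definition is_hom (k : fieldType) (A : falgType k) (M N : fdmod A)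
    (f : 'Hom(M, N)) : Prop :=
  forall a x, f (act M a x) = act N a (f x).

Definition mod_iso (k : fieldType) (A : falgType k) (M N : fdmod A) : Prop :=
  exists f : 'Hom(M, N), is_hom f /\ bijective f.

Definition is_submod (k : fieldType) (A : falgType k) (M : fdmod A)
    (U : {vspace M}) : Prop :=
  forall a x, x \in U -> act M a x \in U.

Definition simple_submod (k : fieldType) (A : falgType k) (M : fdmod A)
    (U : {vspace M}) : Prop :=
  [/\ is_submod U, U <> 0%VS &
      forall W : {vspace M}, is_submod W -> (W <= U)%VS -> W = 0%VS \/ W = U].

Definition simple_mod (k : fieldType) (A : falgType k) (M : fdmod A) : Prop :=
  simple_submod (fullv : {vspace M}).

Definition semisimple_mod (k : fieldType) (A : falgType k) (M : fdmod A) :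
    Prop :=
  exists (n : nat) (U : 'I_n -> {vspace M}),
    [/\ forall i, simple_submod (U i),
        directv (\sum_(i < n) U i) &
        (\sum_(i < n) U i)%VS = fullv].

Definition essential (k : fieldType) (A : falgType k) (M : fdmod A)
    (U : {vspace M}) : Prop :=
  forall W : {vspace M}, is_submod W -> W <> 0%VS -> (U :&: W)%VS <> 0%VS.

Definition projective (k : fieldType) (A : falgType k) (P : fdmod A) : Prop :=
  forall (M N : fdmod A) (p : 'Hom(M, N)) (f : 'Hom(P, N)),
    is_hom p -> limg p = fullv -> is_hom f ->
    exists g : 'Hom(P, M), is_hom g /\ (p \o g)%VF = f.

Definition injective_mod (k : fieldType) (A : falgType k) (I : fdmod A) :
    Prop :=
  forall (M N : fdmod A) (j : 'Hom(M, N)) (f : 'Hom(M, I)),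
    is_hom j -> lker j = 0%VS -> is_hom f ->
    exists g : 'Hom(N, I), is_hom g /\ (g \o j)%VF = f.

Definition regular_mod (k : fieldType) (A : falgType k) : fdmod A.
Proof.
refine (@FdMod k A A (fun a x => a * x) _ _ _ _) => [a c x y|x c a b|x|a b x] /=.
- by rewrite mulrDr scalerAr.
- by rewrite mulrDl scalerAl.
- exact: mul1r.
- by rewrite mulrA.
Defined.

(* D(A) = Hom_k(A, k), with (a . f)(x) = f(x a). *)
Definition dual_mod (k : fieldType) (A : falgType k) : fdmod A.
Proof.
refine (@FdMod k A 'Hom(A, k^o) (fun a f => (f \o amulr a)%VF) _ _ _ _)
  => [a c f g|f c a b|f|a b f] /=; apply/lfunP=> x.
- by rewrite add_lfunE scale_lfunE !comp_lfunE add_lfunE scale_lfunE.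
- by rewrite add_lfunE scale_lfunE !comp_lfunE !lfunE /= mulrDr -scalerAr linearP.
- by rewrite comp_lfunE lfunE /= mulr1.
- by rewrite !comp_lfunE !lfunE /= mulrA.
Defined.

Definition dsum_mod (k : fieldType) (A : falgType k) (M N : fdmod A) : fdmod A.
Proof.
refine (@FdMod k A (M * N)%type (fun a v => (act M a v.1, act N a v.2)) _ _ _ _)
  => [a c [x1 x2] [y1 y2]|[x1 x2] c a b|[x1 x2]|a b [x1 x2]] /=.
- by rewrite !act_linear.
- by rewrite !act_linearl.
- by rewrite !act1.
- by rewrite !actM.
Defined.

Definition power_mod (k : fieldType) (A : falgType k) (M : fdmod A) (n : nat) :
  fdmod A.
Proof.
refine (@FdMod k A {ffun 'I_n -> M}
          (fun a v => [ffun i => act M a ((v : {ffun 'I_n -> M}) i)]) _ _ _ _)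
  => [a c v w|v c a b|v|a b v] /=; apply/ffunP=> i; rewrite !ffunE.
- by rewrite act_linear.
- by rewrite act_linearl.
- by rewrite act1.
- by rewrite actM.
Defined.

Definition in_add (k : fieldType) (A : falgType k) (M X : fdmod A) : Prop :=
  exists (n : nat) (Y : fdmod A), mod_iso (dsum_mod X Y) (power_mod M n).

Definition gen_cogen (k : fieldType) (A : falgType k) (M : fdmod A) : Prop :=
  in_add M (regular_mod A) /\ in_add M (dual_mod A).

Definition self_injective (k : fieldType) (A : falgType k) : Prop :=
  injective_mod (regular_mod A).

Definition semisimple_alg (k : fieldType) (A : falgType k) : Prop :=
  semisimple_mod (regular_mod A).

Record proj_resolution (k : fieldType) (A : falgType k) (M : fdmod A) :=
  ProjResolution {
    pr_mod : nat -> fdmod A;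
    pr_aug : 'Hom(pr_mod 0%N, M);
    pr_d : forall i, 'Hom(pr_mod i.+1, pr_mod i);
    pr_proj : forall i, projective (pr_mod i);
    pr_aug_hom : is_hom pr_aug;
    pr_d_hom : forall i, is_hom (pr_d i);
    pr_aug_surj : limg pr_aug = fullv;
    pr_exact0 : limg (pr_d 0%N) = lker pr_aug;
    pr_exact : forall i, limg (pr_d i.+1) = lker (pr_d i)
  }.

Record inj_resolution (k : fieldType) (A : falgType k) (M : fdmod A) :=
  InjResolution {
    ir_mod : nat -> fdmod A;
    ir_aug : 'Hom(M, ir_mod 0%N);
    ir_d : forall i, 'Hom(ir_mod i, ir_mod i.+1);
    ir_inj : forall i, injective_mod (ir_mod i);
    ir_aug_hom : is_hom ir_aug;
    ir_d_hom : forall i, is_hom (ir_d i);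
    ir_aug_inj : lker ir_aug = 0%VS;
    ir_exact0 : limg ir_aug = lker (ir_d 0%N);
    ir_exact : forall i, limg (ir_d i) = lker (ir_d i.+1)
  }.

Definition minimal_ir (k : fieldType) (A : falgType k) (M : fdmod A)
    (R : inj_resolution M) : Prop :=
  essential (limg (ir_aug R)) /\ forall i, essential (limg (ir_d R i)).

(* Ext^i_A(M, N) = 0: the i-th cohomology of Hom_A(P, N) vanishes, where P is a
   projective resolution of M.  Any two resolutions give the same answer. *)

Definition is_cocycle (k : fieldType) (A : falgType k) (M N : fdmod A)
    (P : proj_resolution M) (i : nat) (f : 'Hom(pr_mod P i, N)) : Prop :=
  is_hom f /\ (f \o pr_d P i)%VF = 0.

Definition is_coboundary (k : fieldType) (A : falgType k) (M N : fdmod A)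
    (P : proj_resolution M) (i : nat) : 'Hom(pr_mod P i, N) -> Prop :=
  match i with
  | 0%N => fun f => f = 0
  | j.+1 => fun f =>
      exists g : 'Hom(pr_mod P j, N), is_hom g /\ f = (g \o pr_d P j)%VF
  end.

Definition Ext_zero (k : fieldType) (A : falgType k) (i : nat)
    (M N : fdmod A) : Prop :=
  exists P : proj_resolution M,
    forall f : 'Hom(pr_mod P i, N), is_cocycle f -> is_coboundary f.

Definition projdim (k : fieldType) (A : falgType k) (M : fdmod A) : enat :=
  eleast (fun n => exists P : proj_resolution M,
    forall i, (n < i)%N -> mod_zero (pr_mod P i)).

Definition gldim (k : fieldType) (A : falgType k) : enat :=
  esup (fun x => exists M : fdmod A, x = projdim M).

(* The set of such t contains 0 and is closed downwards, and it does not depend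
   on the choice of R, which is unique up to isomorphism. *)
Definition domdim (k : fieldType) (A : falgType k) : enat :=
  esup (fun x => exists (t : nat) (R : inj_resolution (regular_mod A)),
    [/\ x = Fin t, minimal_ir R &
        forall i, (i < t)%N -> projective (ir_mod R i)]).

Lemma act_lfunE (k : fieldType) (A : falgType k) (M : fdmod A) (a : A) (x : M) :
  linfun (act M a) x = act M a x.
Proof.
pose l := GRing.isLinear.Build k M M _ (act M a) (@act_linear _ _ M a).
pose f : {linear M -> M} := HB.pack (act M a) l.
exact: (lfunE f).
Qed.

Definition hom_defect (k : fieldType) (A : falgType k) (M N : fdmod A) (a : A)
    (f : 'Hom(M, N)) : 'Hom(M, N) :=
  ((f \o linfun (act M a)) - (linfun (act N a) \o f))%VF.

Lemma hom_defect_is_linear (k : fieldType) (A : falgType k) (M N : fdmod A)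
  (a : A) : linear (@hom_defect k A M N a).
Proof.
move=> c f g; rewrite /hom_defect comp_lfunDl comp_lfunDr -comp_lfunZl.
by rewrite -comp_lfunZr scalerBr opprD addrACA.
Qed.

HB.instance Definition _ (k : fieldType) (A : falgType k) (M N : fdmod A)
    (a : A) :=
  GRing.isLinear.Build k 'Hom(M, N) 'Hom(M, N) _ (@hom_defect k A M N a)
    (@hom_defect_is_linear k A M N a).

Definition homv (k : fieldType) (A : falgType k) (M N : fdmod A) :
    {vspace 'Hom(M, N)} :=
  (\bigcap_(i < \dim {:A})
     lker (linfun (@hom_defect k A M N (vbasis {:A})`_i)))%VS.

Lemma homvP (k : fieldType) (A : falgType k) (M N : fdmod A) (f : 'Hom(M, N)) :
  f \in homv M N <-> is_hom f.
Proof.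
have defE a x : hom_defect a f x = f (act M a x) - act N a (f x).
  by rewrite /hom_defect add_lfunE opp_lfunE !comp_lfunE !act_lfunE.
split=> [|homf].
  rewrite memvE => /subv_bigcapP fK a x.
  have fKi (i : 'I_(\dim {:A})) (y : M) :
      f (act M (vbasis {:A})`_i y) = act N (vbasis {:A})`_i (f y).
    have := fK i isT; rewrite -memvE memv_ker lfunE /= => /eqP/lfunP/(_ y).
    by rewrite defE lfunE /= => /eqP; rewrite subr_eq0 => /eqP.
  pose hM y : {linear A -> M} := HB.pack (act M ^~ y)
    (GRing.isLinear.Build k A M _ (act M ^~ y) (act_linearl y)).
  pose hN y : {linear A -> N} := HB.pack (act N ^~ y)
    (GRing.isLinear.Build k A N _ (act N ^~ y) (act_linearl y)).
  rewrite (coord_vbasis (memvf a)) -[LHS]/(f (hM x _)) -[RHS]/(hN (f x) _).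
  rewrite !linear_sum; apply: eq_bigr => i _; rewrite !linearZ /=.
  by rewrite fKi.
rewrite memvE; apply/subv_bigcapP=> i _; rewrite -memvE memv_ker lfunE /=.
by apply/eqP/lfunP=> x; rewrite defE homf subrr lfunE.
Qed.

(* End_A(M), with f * g the composite f \o g.  M must be nonzero for this to be
   an [falgType]; generator-cogenerators are, see [gen_cogen_nonzero]. *)
Definition endo (k : fieldType) (A : falgType k) (M : fdmod A)
    (nzM : ~ mod_zero M) : Type :=
  subvs_of (homv M M).

Section EndoAlgebra.
Context (k : fieldType) (A : falgType k) (M : fdmod A) (nzM : ~ mod_zero M).

HB.instance Definition _ := Vector.on (endo nzM).

Lemma endo1_subproof : (\1%VF : 'End(M)) \in homv M M.
Proof. by apply/homvP=> a x; rewrite !id_lfunE. Qed.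

Lemma endoM_subproof (f g : endo nzM) : (vsval f \o vsval g)%VF \in homv M M.
Proof.
have /homvP homf := subvsP f; have /homvP homg := subvsP g.
by apply/homvP=> a x; rewrite !comp_lfunE homg homf.
Qed.

Definition endo1 : endo nzM := Subvs endo1_subproof.
Definition endoM (f g : endo nzM) : endo nzM := Subvs (endoM_subproof f g).

Lemma endo_mulA : associative endoM.
Proof. by move=> f g h; apply/val_inj; rewrite /= comp_lfunA. Qed.

Lemma endo_mul1l : left_id endo1 endoM.
Proof. by move=> f; apply/val_inj; rewrite /= comp_lfun1l. Qed.

Lemma endo_mul1r : right_id endo1 endoM.
Proof. by move=> f; apply/val_inj; rewrite /= comp_lfun1r. Qed.

Lemma endo_mulDl : left_distributive endoM +%R.
Proof. by move=> f g h; apply/val_inj; rewrite /= comp_lfunDl. Qed.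

Lemma endo_mulDr : right_distributive endoM +%R.
Proof. by move=> f g h; apply/val_inj; rewrite /= comp_lfunDr. Qed.

Lemma endo1_neq0 : endo1 != 0.
Proof.
apply/eqP=> /(congr1 vsval) /= /lfunP id0; apply: nzM => x.
by have := id0 x; rewrite id_lfunE lfunE.
Qed.

HB.instance Definition _ := GRing.Zmodule_isNzRing.Build (endo nzM)
  endo_mulA endo_mul1l endo_mul1r endo_mulDl endo_mulDr endo1_neq0.

Lemma endo_scaleAl (c : k) (f g : endo nzM) : c *: (f * g) = (c *: f) * g.
Proof. by apply/val_inj; rewrite /= comp_lfunZl. Qed.

HB.instance Definition _ :=
  GRing.Lmodule_isLalgebra.Build k (endo nzM) endo_scaleAl.

Lemma endo_scaleAr (c : k) (f g : endo nzM) : c *: (f * g) = f * (c *: g).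
Proof. by apply/val_inj; rewrite /= comp_lfunZr. Qed.

HB.instance Definition _ :=
  GRing.Lalgebra_isAlgebra.Build k (endo nzM) endo_scaleAr.

HB.instance Definition _ := Algebra_isFalgebra.Build k (endo nzM).

Lemma endo_mulE (f g : endo nzM) (x : M) :
  vsval (f * g) x = vsval f (vsval g x).
Proof. by rewrite comp_lfunE. Qed.

End EndoAlgebra.

Definition End_alg (k : fieldType) (A : falgType k) (M : fdmod A)
    (nzM : ~ mod_zero M) : falgType k := endo nzM.

Lemma gen_cogen_nonzero (k : fieldType) (A : falgType k) (M : fdmod A) :
  gen_cogen M -> ~ mod_zero M.
Proof.
case=> [[n [Y [f [_ bijf]]]] _] M0; have := oner_neq0 A; case/eqP.
have /(bij_inj bijf) [] // : f ((1 : A), 0 : Y) = f (0, 0).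
by apply/ffunP=> i; rewrite [LHS]M0 [RHS]M0.
Qed.

Definition rigdim (k : fieldType) (A : falgType k) : enat :=
  esup (fun x => exists (M : fdmod A) (gcM : gen_cogen M),
    let E := End_alg (gen_cogen_nonzero gcM) in
    efinite (gldim E) /\ x = domdim E).

Definition num_simples (k : fieldType) (A : falgType k) (n : nat) : Prop :=
  exists S : 'I_n -> fdmod A,
    [/\ forall i, simple_mod (S i),
        forall i j, mod_iso (S i) (S j) -> i = j &
        forall T : fdmod A, simple_mod T -> exists i, mod_iso T (S i)].

Definition TC1 (k : fieldType) : Prop :=
  forall L : falgType k,
    (forall i, (1 <= i)%N -> Ext_zero i (dual_mod L) (regular_mod L)) ->
    self_injective L.

Definition YC (k : fieldType) : Prop :=
  exists phi : nat -> nat,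
    (forall n, (0 < n)%N -> (0 < phi n)%N) /\
    forall (L : falgType k) (n : nat),
      num_simples L n -> efinite (domdim L) -> ele (domdim L) (Fin (phi n)).

(* Main.v *)
(* Let M be a generator-cogenerator of A-mod and E = End_A(M).  By Mueller's
   theorem domdim E >= t + 2 iff Ext^i_A(M, M) = 0 for 1 <= i <= t: the functor
   Hom_A(-, M) turns a projective resolution of M into a coresolution of E by
   projective-injectives, and Hom_E(-, M) turns it back.

   If rigdim A is infinite there are such M with this vanishing for every t.
   As A and D(A) lie in add(M), Ext^i_A(D(A), A) = 0 for all i >= 1, so (TC1)
   makes A self-injective.  For (YC), fix t and M.  Since A is not semisimple
   and gldim E is finite, domdim E is finite, hence Ext^i_A(X, Y) <> 0 for some
   i and some indecomposable summands X, Y of M.  For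
   N = A + D(A) + X + Y the algebra End_A(N) has finite dominant dimension
   at least t + 2, while its number of simples is at most 2 more than the number
   of indecomposable summands of A + D(A); this contradicts (YC) for t large. *)

(* For (YC) the obstacle is that M may acquire arbitrarily many summands as t grows, so a bound in
   the number of simples of End_A(M) says nothing. Passing to one failing pair X, Y keeps the number
   of summands independent of t. Finiteness of domdim E rests on an exchange: a d-th cosyzygy inside
   projective-injectives costs d units of projective dimension, so projective dimensions bounded by
   d together with domdim E > d force every E-module to be projective. Von Neumann regularity of
   maps then carries this back to A along Hom_A(-, M). Uniqueness of decompositions is avoided by
   writing identity maps as finite sums of maps through a class of modules. Vanishing of Ext and
   lower bounds on dominant dimension are shown closed under add by lifting such a sum and comparing
   the lift with the identity. The same sums count simples: each term through a module with local
   endomorphism ring contributes at most one simple E-module. *)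
From HB Require Import structures.
Require Import Defs.
From mathcomp Require Import all_boot all_algebra all_field.
From mathcomp Require Import boolp.

Set Implicit Arguments.
Unset Strict Implicit.
Unset Printing Implicit Defensive.

Import GRing.Theory.
Local Open Scope ring_scope.

(* Opaque, so that unification never confuses [lfun_of f] with another map. *)
Fact lfun_of_subproof (k : fieldType) (U V : vectType k) (f : U -> V) :
  linear f -> {g : 'Hom(U, V) | forall x, g x = f x}.
Proof.
move=> lf; exists (linfun (HB.pack f (GRing.isLinear.Build k U V _ f lf) :
  {linear U -> V})) => x; exact: lfunE.
Qed.

Definition lfun_of (k : fieldType) (U V : vectType k) (f : U -> V)
  (lf : linear f) : 'Hom(U, V) := sval (lfun_of_subproof lf).

Lemma lfun_ofE (k : fieldType) (U V : vectType k) (f : U -> V) (lf : linear f)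
  x : lfun_of lf x = f x.
Proof. exact: (svalP (lfun_of_subproof lf)). Qed.

(** * Modules *)

Section Homs.
Context (k : fieldType) (A : falgType k).
Implicit Types (M N X Y Z P I J K C : fdmod A) (a : A).

Lemma actD M a (x y : M) : act M a (x + y) = act M a x + act M a y.
Proof. by have := @act_linear _ _ M a 1 x y; rewrite !scale1r. Qed.

Lemma act0r M a : act M a 0 = 0.
Proof. by apply: (addrI (act M a 0)); rewrite -actD !addr0. Qed.

Lemma actZr M a c (x : M) : act M a (c *: x) = c *: act M a x.
Proof. by have := @act_linear _ _ M a c x 0; rewrite act0r !addr0. Qed.

Lemma actNr M a (x : M) : act M a (- x) = - act M a x.
Proof. by rewrite -scaleN1r actZr scaleN1r. Qed.

Lemma actBr M a (x y : M) : act M a (x - y) = act M a x - act M a y.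
Proof. by rewrite actD actNr. Qed.

Lemma actDl M a b (x : M) : act M (a + b) x = act M a x + act M b x.
Proof. by have := @act_linearl _ _ M x 1 a b; rewrite !scale1r. Qed.

Lemma act0l M (x : M) : act M 0 x = 0.
Proof. by apply: (addrI (act M 0 x)); rewrite -actDl !addr0. Qed.

Lemma actZl M a c (x : M) : act M (c *: a) x = c *: act M a x.
Proof. by have := @act_linearl _ _ M x c a 0; rewrite act0l !addr0. Qed.

Lemma actBl M a b (x : M) : act M (a - b) x = act M a x - act M b x.
Proof. by apply: (addIr (act M b x)); rewrite -actDl !subrK. Qed.

Lemma act_suml M (x : M) T (r : seq T) (F : T -> A) :
  act M (\sum_(i <- r) F i) x = \sum_(i <- r) act M (F i) x.
Proof. exact: (big_morph (act M^~ x) (fun a b => actDl a b x) (act0l _)). Qed.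

Lemma hom_id M : is_hom (\1%VF : 'Hom(M, M)).
Proof. by move=> a x; rewrite !id_lfunE. Qed.

Lemma hom0 M N : is_hom (0 : 'Hom(M, N)).
Proof. by move=> a x; rewrite !lfunE act0r. Qed.

Lemma hom_comp M N X (g : 'Hom(N, X)) (f : 'Hom(M, N)) :
  is_hom g -> is_hom f -> is_hom (g \o f)%VF.
Proof. by move=> hg hf a x; rewrite !comp_lfunE hf hg. Qed.

Lemma homD M N (f g : 'Hom(M, N)) : is_hom f -> is_hom g -> is_hom (f + g).
Proof. by move=> hf hg a x; rewrite !add_lfunE hf hg actD. Qed.

Lemma homN M N (f : 'Hom(M, N)) : is_hom f -> is_hom (- f).
Proof. by move=> hf a x; rewrite !opp_lfunE hf actNr. Qed.

Lemma homB M N (f g : 'Hom(M, N)) : is_hom f -> is_hom g -> is_hom (f - g).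
Proof. by move=> hf hg; apply: homD => //; apply: homN. Qed.

Lemma homZ M N c (f : 'Hom(M, N)) : is_hom f -> is_hom (c *: f).
Proof. by move=> hf a x; rewrite !scale_lfunE hf actZr. Qed.

Lemma lker_eq0P (U V : vectType k) (f : 'Hom(U, V)) :
  lker f = 0%VS <-> forall x, f x = 0 -> x = 0.
Proof.
split=> [/eqP/lker0P inj x fx0|inj]; first by apply: inj; rewrite fx0 linear0.
apply/eqP/lker0P => x y /eqP; rewrite -subr_eq0 -linearB => /eqP/inj/eqP.
by rewrite subr_eq0 => /eqP.
Qed.

Lemma limg_fullP (U V : vectType k) (f : 'Hom(U, V)) :
  limg f = fullv <-> forall y, exists x, f x = y.
Proof.
split=> [fE y|surj].
  have /memv_imgP[x _ ->] : y \in limg f by rewrite fE memvf.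
  by exists x.
apply/eqP; rewrite eqEsubv subvf; apply/subvP => y _.
by have [x <-] := surj y; rewrite memv_img ?memvf.
Qed.

Lemma limgP (U V : vectType k) (f : 'Hom(U, V)) y :
  y \in limg f <-> exists x, f x = y.
Proof.
split=> [/memv_imgP[x _ ->]|[x <-]]; first by exists x.
by rewrite memv_img ?memvf.
Qed.

Definition mono (U V : vectType k) (f : 'Hom(U, V)) := forall x, f x = 0 -> x = 0.
Definition epi (U V : vectType k) (f : 'Hom(U, V)) := forall y, exists x, f x = y.

Record ses X Y Z (i : 'Hom(X, Y)) (p : 'Hom(Y, Z)) : Prop := Ses {
  ses_homi : is_hom i;
  ses_homp : is_hom p;
  ses_mono : mono i;
  ses_epi : epi p;
  ses_pi : forall x, p (i x) = 0;
  ses_ex : forall y, p y = 0 -> exists x, i x = y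
}.

Lemma mono_eq (U V : vectType k) (f : 'Hom(U, V)) :
  mono f -> forall x y, f x = f y -> x = y.
Proof. by move=> /lker_eq0P/eqP/lker0P. Qed.

(** The linear map [i^-1] need not be A-linear; since [f] lands in the image of [i] and [i] is
    injective, the composite still commutes with A. *)
Lemma lift_mono X Y N (i : 'Hom(X, Y)) (f : 'Hom(N, Y)) :
  is_hom i -> mono i -> is_hom f -> (forall x, exists y, i y = f x) ->
  exists g : 'Hom(N, X), is_hom g /\ (i \o g)%VF = f.
Proof.
move=> hi mi hf fi; exists (i^-1 \o f)%VF.
have E x : i ((i^-1 \o f)%VF x) = f x.
  by rewrite comp_lfunE limg_lfunVK //; apply/limgP.
split=> [a x|]; last by apply/lfunP => x; rewrite comp_lfunE E.
by apply: (mono_eq mi); rewrite hi !E hf.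
Qed.

Lemma factor_epi X Y N (p : 'Hom(X, Y)) (f : 'Hom(X, N)) :
  is_hom p -> epi p -> is_hom f -> (forall x, p x = 0 -> f x = 0) ->
  exists g : 'Hom(Y, N), is_hom g /\ (g \o p)%VF = f.
Proof.
move=> hp ep hf fp; exists (f \o p^-1)%VF.
have E x : (f \o p^-1)%VF (p x) = f x.
  have : f (p^-1%VF (p x) - x) = 0.
    by apply: fp; rewrite linearB /= limg_lfunVK ?subrr //; apply/limgP; exists x.
  by move/eqP; rewrite linearB subr_eq0 comp_lfunE => /eqP.
split=> [a y|]; last by apply/lfunP => x; rewrite comp_lfunE E.
by have [x <-] := ep y; rewrite -hp !E hf.
Qed.

Lemma bij_hom_inv X Y (f : 'Hom(X, Y)) :
  is_hom f -> mono f -> epi f ->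
  exists g : 'Hom(Y, X), [/\ is_hom g, (f \o g = \1)%VF & (g \o f = \1)%VF].
Proof.
move=> hf mf ef; have [g [hg fg]] := lift_mono hf mf (@hom_id Y) (fun y => 
  let: ex_intro x e := ef y in ex_intro _ x (etrans e (esym (id_lfunE _)))).
exists g; split=> //; apply/lfunP => x; apply: (mono_eq mf).
by rewrite !id_lfunE -comp_lfunE comp_lfunA fg comp_lfunE id_lfunE.
Qed.

Lemma mod_isoP X Y (f : 'Hom(X, Y)) : is_hom f -> mono f -> epi f -> mod_iso X Y.
Proof.
move=> hf mf ef; exists f; split=> //.
have [g [_ fg gf]] := bij_hom_inv hf mf ef.
exists g => x; first by rewrite -comp_lfunE gf id_lfunE.
by rewrite -comp_lfunE fg id_lfunE.
Qed.

Section Sub.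
Context (M : fdmod A) (U : {vspace M}) (hU : is_submod U).

Definition subact (a : A) (x : subvs_of U) : subvs_of U :=
  Subvs (hU a (subvsP x)).

Definition sub_mod : fdmod A.
Proof.
refine (@FdMod k A (subvs_of U) subact _ _ _ _).
- by move=> a c x y; apply/val_inj; rewrite /= actD actZr.
- by move=> x c a b; apply/val_inj; rewrite /= actDl actZl.
- by move=> x; apply/val_inj; rewrite /= act1.
- by move=> a b x; apply/val_inj; rewrite /= actM.
Defined.

Definition sub_incl : 'Hom(sub_mod, M) := linfun (@vsval k M U).

Lemma sub_inclE (x : sub_mod) : sub_incl x = vsval x.
Proof. exact: lfunE. Qed.

Lemma hom_sub_incl : is_hom sub_incl.
Proof. by move=> a x; rewrite !sub_inclE. Qed.

Lemma mono_sub_incl : mono sub_incl.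
Proof. by move=> x; rewrite sub_inclE => x0; apply/val_inj. Qed.

Lemma sub_incl_imgP y : y \in U <-> exists x, sub_incl x = y.
Proof.
split=> [yU|[x <-]]; first by exists (Subvs yU); rewrite sub_inclE.
by rewrite sub_inclE subvsP.
Qed.

(** The quotient by U is carried by the chosen linear complement [U^C]; this is the projection onto
    it along U, and A acts on the complement through it. *)
Definition quo_pi : 'Hom(M, subvs_of U^C) :=
  (linfun (vsproj U^C) \o daddv_pi U^C U)%VF.

Lemma quo_piK x : x - vsval (quo_pi x) \in U.
Proof.
have dUC : (U^C :&: U = 0)%VS by rewrite capvC capv_compl.
have dCU : (U :&: U^C = 0)%VS by rewrite capv_compl.
have xs : x \in (U^C + U)%VS by rewrite addvC addv_complf memvf.
rewrite comp_lfunE lfunE /= vsprojK ?memv_pi //.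
by rewrite -{1}(daddv_pi_add dUC xs) addrAC subrr add0r memv_pi.
Qed.

Lemma quo_pi_val (y : subvs_of U^C) : quo_pi (vsval y) = y.
Proof.
have dUC : (U^C :&: U = 0)%VS by rewrite capvC capv_compl.
by rewrite comp_lfunE daddv_pi_id ?subvsP // lfunE /= vsvalK.
Qed.

Lemma quo_pi0 x : quo_pi x = 0 <-> x \in U.
Proof.
split=> [px0|xU]; first by have := quo_piK x; rewrite px0 /= subr0.
apply/val_inj/eqP => /=; rewrite -memv0 -(capv_compl U) memv_cap subvsP andbT.
by rewrite -[vsval _](subKr x) memvB ?quo_piK.
Qed.

Definition quoact (a : A) (y : subvs_of U^C) : subvs_of U^C :=
  quo_pi (act M a (vsval y)).

Lemma quoact_pi a x : quoact a (quo_pi x) = quo_pi (act M a x).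
Proof.
apply/eqP; rewrite eq_sym -subr_eq0 -linearB -actBr.
by apply/eqP/quo_pi0/hU/quo_piK.
Qed.

Definition quo_mod : fdmod A.
Proof.
refine (@FdMod k A (subvs_of U^C) quoact _ _ _ _).
- by move=> a c x y; rewrite /quoact /= actD actZr linearP.
- by move=> x c a b; rewrite /quoact actDl actZl linearP.
- by move=> x; rewrite /quoact act1 quo_pi_val.
- by move=> a b x; rewrite quoact_pi -actM.
Defined.

Lemma ses_quo : ses (sub_incl) (quo_pi : 'Hom(M, quo_mod)).
Proof.
split.
- exact: hom_sub_incl.
- by move=> a x; rewrite [RHS]quoact_pi.
- exact: mono_sub_incl.
- by move=> y; exists (vsval y); apply: quo_pi_val.
- by move=> x; apply/quo_pi0; rewrite sub_inclE subvsP.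
- by move=> y /quo_pi0/sub_incl_imgP.
Qed.

End Sub.

Lemma submod_lker M N (f : 'Hom(M, N)) : is_hom f -> is_submod (lker f).
Proof. by move=> hf a x; rewrite !memv_ker hf => /eqP ->; rewrite act0r. Qed.

Lemma submod_limg M N (f : 'Hom(M, N)) : is_hom f -> is_submod (limg f).
Proof.
move=> hf a y /limgP[x <-]; apply/limgP; exists (act M a x); exact: hf.
Qed.

Lemma submod_cap M (U V : {vspace M}) :
  is_submod U -> is_submod V -> is_submod (U :&: V)%VS.
Proof.
by move=> hU hV a x; rewrite !memv_cap => /andP[xU xV]; rewrite hU ?hV.
Qed.

Lemma submod0 M : is_submod (0%VS : {vspace M}).
Proof. by move=> a x; rewrite !memv0 => /eqP ->; rewrite act0r. Qed.

Lemma submodf M : is_submod (fullv : {vspace M}).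
Proof. by move=> a x _; rewrite memvf. Qed.

Lemma ses_ker Y Z (p : 'Hom(Y, Z)) :
  is_hom p -> epi p -> exists X (i : 'Hom(X, Y)), ses i p.
Proof.
move=> hp ep; exists (sub_mod (submod_lker hp)), (sub_incl (submod_lker hp)).
split=> //; [exact: hom_sub_incl|exact: mono_sub_incl| |].
  move=> x; apply/eqP; rewrite -memv_ker.
  by apply/(sub_incl_imgP (submod_lker hp)); exists x.
by move=> y /eqP; rewrite -memv_ker => /(sub_incl_imgP (submod_lker hp)).
Qed.

Lemma ses_coker X Y (i : 'Hom(X, Y)) :
  is_hom i -> mono i -> exists Z (p : 'Hom(Y, Z)), ses i p.
Proof.
move=> hi mi; have [_ hp _ ep pi ex] := ses_quo (submod_limg hi).
exists (quo_mod (submod_limg hi)), (quo_pi (limg i)); split=> //.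
  by move=> x; apply/quo_pi0/limgP; exists x.
by move=> y /quo_pi0/limgP.
Qed.

Lemma image_factor X Y (f : 'Hom(X, Y)) : is_hom f ->
  exists Z (p : 'Hom(X, Z)) (i : 'Hom(Z, Y)),
    [/\ is_hom p, is_hom i, epi p, mono i & (i \o p)%VF = f].
Proof.
move=> hf; pose hI := submod_limg hf.
have [|g [hg fE]] := lift_mono (hom_sub_incl (hU:=hI)) (@mono_sub_incl _ _ hI) hf.
  by move=> x; apply/sub_incl_imgP/limgP; exists x.
exists (sub_mod hI), g, (sub_incl hI); split=> //.
- exact: hom_sub_incl.
- move=> y; have /limgP[x xE] : vsval y \in limg f by apply: subvsP.
  exists x; apply: (mono_eq (mono_sub_incl (hU := hI))).
  by rewrite -comp_lfunE fE xE sub_inclE.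
- exact: mono_sub_incl.
Qed.

Lemma proj_lift P M N (p : 'Hom(M, N)) (f : 'Hom(P, N)) :
  projective P -> is_hom p -> epi p -> is_hom f ->
  exists g : 'Hom(P, M), is_hom g /\ (p \o g)%VF = f.
Proof. by move=> hP hp /limg_fullP ep hf; apply: hP. Qed.

Lemma inj_extend I M N (j : 'Hom(M, N)) (f : 'Hom(M, I)) :
  injective_mod I -> is_hom j -> mono j -> is_hom f ->
  exists g : 'Hom(N, I), is_hom g /\ (g \o j)%VF = f.
Proof. by move=> hI hj /lker_eq0P mj hf; apply: hI. Qed.

End Homs.

#[global] Hint Resolve hom_id hom0 hom_comp homD homN homB homZ : homdb.

(** * Finite sums of maps through a class, and closure under add *)

Section Thru.
Context (k : fieldType) (A : falgType k).
Implicit Types (M N W X Y Z P I J K Q V : fdmod A) (C D : fdmod A -> Prop).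

(* [thru C f]: f is a finite sum of maps factoring through members of C.  Thus
   X is in add(C) iff its identity is such a sum, which is [inadd C X]. *)
Inductive thru C X Y : 'Hom(X, Y) -> Prop :=
| thru0 : thru C 0
| thruS Z (al : 'Hom(X, Z)) (be : 'Hom(Z, Y)) f :
    C Z -> is_hom al -> is_hom be -> thru C f -> thru C ((be \o al)%VF + f).

Definition inadd C X := thru C (\1%VF : 'Hom(X, X)).

Lemma thru_hom C X Y (f : 'Hom(X, Y)) : thru C f -> is_hom f.
Proof. by elim=> [|Z al be g _ hal hbe _ hg]; auto with homdb. Qed.

Lemma thru_comp C X Y Z (al : 'Hom(X, Z)) (be : 'Hom(Z, Y)) :
  C Z -> is_hom al -> is_hom be -> thru C (be \o al)%VF.
Proof.
by move=> CZ hal hbe; rewrite -[(_ \o _)%VF]addr0; apply: thruS => //; apply: thru0.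
Qed.

Lemma thruD C X Y (f g : 'Hom(X, Y)) : thru C f -> thru C g -> thru C (f + g).
Proof.
elim=> [|Z al be f' CZ hal hbe _ IH] tg; first by rewrite add0r.
by rewrite -addrA; apply: thruS => //; apply: IH.
Qed.

Lemma thru_sum C X Y (T : Type) (r : seq T) (F : T -> 'Hom(X, Y)) :
  (forall i, thru C (F i)) -> thru C (\sum_(i <- r) F i).
Proof. by move=> tF; apply: big_ind => //; [exact: thru0|exact: thruD]. Qed.

(** Transitivity of add: the identity of each middle module Z is expanded as a sum through D and
    inserted between the two factors. *)
Lemma thru_bind C D W X Y V (f : 'Hom(X, Y)) (g : 'Hom(W, X)) (h : 'Hom(Y, V)) :
  (forall Z, C Z -> inadd D Z) -> is_hom g -> is_hom h -> thru C f ->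
  thru D (h \o f \o g)%VF.
Proof.
move=> CD hg hh; elim=> [|Z al be f' CZ hal hbe _ IH].
  by rewrite comp_lfun0r comp_lfun0l; apply: thru0.
rewrite comp_lfunDr comp_lfunDl; apply: thruD => // {IH}.
have -> : (h \o (be \o al) \o g = (h \o be) \o \1 \o (al \o g))%VF.
  by rewrite comp_lfun1r !comp_lfunA.
elim: {CD CZ}(CD _ CZ) => [|T a b u DT ha hb _ IH].
  by rewrite comp_lfun0r comp_lfun0l; apply: thru0.
rewrite comp_lfunDr comp_lfunDl; apply: thruD => //.
rewrite !comp_lfunA -2!comp_lfunA; apply: thru_comp => //; auto with homdb.
Qed.

Lemma inadd_self C X : C X -> inadd C X.
Proof.
move=> CX; rewrite /inadd -[\1%VF]comp_lfun1l; apply: thru_comp => //;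
  exact: hom_id.
Qed.

Lemma thru_comp2 C W X Y V (f : 'Hom(X, Y)) (g : 'Hom(W, X)) (h : 'Hom(Y, V)) :
  is_hom g -> is_hom h -> thru C f -> thru C (h \o f \o g)%VF.
Proof. by move=> hg hh; apply: thru_bind => // Z; apply: inadd_self. Qed.

Lemma thru_compl C X Y V (f : 'Hom(X, Y)) (h : 'Hom(Y, V)) :
  is_hom h -> thru C f -> thru C (h \o f)%VF.
Proof.
by move=> hh /(thru_comp2 (@hom_id _ _ X) hh); rewrite comp_lfun1r.
Qed.

Lemma inadd_bind C D X :
  (forall Z, C Z -> inadd D Z) -> inadd C X -> inadd D X.
Proof.
move=> CD /(thru_bind CD (@hom_id _ _ _) (@hom_id _ _ _)).
by rewrite !comp_lfun1r.
Qed.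

Lemma inadd_sub C D X : (forall Z, C Z -> D Z) -> inadd C X -> inadd D X.
Proof. by move=> CD; apply: inadd_bind => Z /CD; apply: inadd_self. Qed.

Lemma inadd_retract C X Y (al : 'Hom(X, Y)) (be : 'Hom(Y, X)) :
  is_hom al -> is_hom be -> (be \o al = \1)%VF -> inadd C Y -> inadd C X.
Proof.
move=> hal hbe E /(thru_comp2 hal hbe).
by rewrite /inadd comp_lfun1r E.
Qed.

Section DSum.
Context (M N : fdmod A).

Lemma ds_in1_linear : linear (fun x : M => (x, 0) : dsum_mod M N).
Proof. by move=> c x y; congr pair; rewrite /= scaler0 addr0. Qed.
Lemma ds_in2_linear : linear (fun x : N => (0, x) : dsum_mod M N).
Proof. by move=> c x y; congr pair; rewrite /= scaler0 addr0. Qed.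
Lemma ds_pr1_linear : linear (fun x : dsum_mod M N => (x : M * N).1).
Proof. by []. Qed.
Lemma ds_pr2_linear : linear (fun x : dsum_mod M N => (x : M * N).2).
Proof. by []. Qed.

Definition ds_in1 : 'Hom(M, dsum_mod M N) := lfun_of ds_in1_linear.
Definition ds_in2 : 'Hom(N, dsum_mod M N) := lfun_of ds_in2_linear.
Definition ds_pr1 : 'Hom(dsum_mod M N, M) := lfun_of ds_pr1_linear.
Definition ds_pr2 : 'Hom(dsum_mod M N, N) := lfun_of ds_pr2_linear.

Lemma hom_in1 : is_hom ds_in1.
Proof. by move=> a x; rewrite !lfun_ofE /= act0r. Qed.
Lemma hom_in2 : is_hom ds_in2.
Proof. by move=> a x; rewrite !lfun_ofE /= act0r. Qed.
Lemma hom_pr1 : is_hom ds_pr1.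
Proof. by move=> a x; rewrite !lfun_ofE. Qed.
Lemma hom_pr2 : is_hom ds_pr2.
Proof. by move=> a x; rewrite !lfun_ofE. Qed.

Lemma ds_pr1_in1 : (ds_pr1 \o ds_in1 = \1)%VF.
Proof. by apply/lfunP => x; rewrite id_lfunE comp_lfunE !lfun_ofE. Qed.
Lemma ds_pr2_in2 : (ds_pr2 \o ds_in2 = \1)%VF.
Proof. by apply/lfunP => x; rewrite id_lfunE comp_lfunE !lfun_ofE. Qed.

Lemma ds_id : (\1 = (ds_in1 \o ds_pr1) + (ds_in2 \o ds_pr2))%VF.
Proof.
apply/lfunP => -[x y]; rewrite id_lfunE add_lfunE !comp_lfunE.
by rewrite !lfun_ofE; congr pair; rewrite /= ?addr0 ?add0r.
Qed.

End DSum.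

Lemma inadd_dsum C M N : inadd C M -> inadd C N -> inadd C (dsum_mod M N).
Proof.
move=> CM CN; rewrite /inadd ds_id; apply: thruD.
  have := thru_comp2 (@hom_pr1 M N) (@hom_in1 M N) CM.
  by rewrite comp_lfun1r.
have := thru_comp2 (@hom_pr2 M N) (@hom_in2 M N) CN.
by rewrite comp_lfun1r.
Qed.

Section Power.
Context (M : fdmod A) (n : nat).

Lemma pow_pr_linear i : linear (fun v : power_mod M n => (v : {ffun 'I_n -> M}) i).
Proof. by move=> c v w; rewrite !ffunE. Qed.
Lemma pow_in_linear i :
  linear (fun x : M => [ffun j => if j == i then x else 0] : power_mod M n).
Proof.
move=> c x y; apply/ffunP => j; rewrite !ffunE; case: ifP => // _.
by rewrite scaler0 addr0.
Qed.

Definition pow_pr i : 'Hom(power_mod M n, M) := lfun_of (pow_pr_linear i).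
Definition pow_in i : 'Hom(M, power_mod M n) := lfun_of (pow_in_linear i).

Lemma hom_pow_pr i : is_hom (pow_pr i).
Proof. by move=> a x; rewrite !lfun_ofE ffunE. Qed.
Lemma hom_pow_in i : is_hom (pow_in i).
Proof.
move=> a x; rewrite !lfun_ofE; apply/ffunP => j; rewrite !ffunE.
by case: ifP => // _; rewrite act0r.
Qed.

Lemma pow_pr_in i x : pow_pr i (pow_in i x) = x.
Proof. by rewrite !lfun_ofE ffunE eqxx. Qed.

Lemma pow_id : (\1 = \sum_i (pow_in i \o pow_pr i))%VF.
Proof.
apply/lfunP => v; rewrite sum_lfunE id_lfunE; apply/ffunP => j.
rewrite sum_ffunE (bigD1 j) //= big1 ?addr0 => [|i ij].
  by rewrite comp_lfunE !lfun_ofE ffunE eqxx.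
by rewrite comp_lfunE !lfun_ofE ffunE eq_sym (negPf ij).
Qed.

Lemma inadd_power : inadd (eq M) (power_mod M n).
Proof.
rewrite /inadd pow_id; apply: thru_sum => i; apply: thru_comp => //.
  exact: hom_pow_pr.
exact: hom_pow_in.
Qed.

Lemma hom_sum X Y (T : Type) (r : seq T) (F : T -> 'Hom(X, Y)) :
  (forall i, is_hom (F i)) -> is_hom (\sum_(i <- r) F i).
Proof. by move=> hF; apply: big_ind => //; auto with homdb. Qed.

Lemma to_power X (f : 'I_n -> 'Hom(X, M)) :
  (forall i, is_hom (f i)) ->
  exists g : 'Hom(X, power_mod M n),
    is_hom g /\ forall i, (pow_pr i \o g)%VF = f i.
Proof.
move=> hf; exists (\sum_i (pow_in i \o f i))%VF; split.
  by apply: hom_sum => i; apply: hom_comp => //; apply: hom_pow_in.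
move=> i; apply/lfunP => x; rewrite comp_lfunE sum_lfunE linear_sum /=.
rewrite (bigD1 i) //= big1 => [|j ij].
  by rewrite addr0 comp_lfunE pow_pr_in.
by rewrite comp_lfunE !lfun_ofE ffunE eq_sym (negPf ij).
Qed.

End Power.

Lemma in_add_inadd M X : in_add M X -> inadd (eq M) X.
Proof.
case=> n [Y [f [hf bf]]].
have mf : mono f by move=> x; rewrite -(linear0 f) => /(bij_inj bf).
have ef : epi f by case: bf => g _ gf y; exists (g y).
have [g [hg _ gf]] := bij_hom_inv hf mf ef.
apply: (inadd_retract (al := f \o ds_in1 X Y) (be := ds_pr1 X Y \o g)%VF)
  (inadd_power M n); try by auto using hom_in1, hom_pr1 with homdb.
by rewrite comp_lfunA -(comp_lfunA _ g) gf comp_lfun1r ds_pr1_in1.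
Qed.

(** The kernel of [be] is a complement of X in N, so one copy of N suffices; this is the way back
    from retracts to [in_add]. *)
Lemma retract_in_add N X (al : 'Hom(X, N)) (be : 'Hom(N, X)) :
  is_hom al -> is_hom be -> (be \o al = \1)%VF -> in_add N X.
Proof.
move=> hal hbe E.
have EE x : be (al x) = x by rewrite -comp_lfunE E id_lfunE.
have ebe : epi be by move=> x; exists (al x).
have [Y [i [hi _ mi _ bi ex]]] := ses_ker hbe ebe.
pose f : 'Hom(dsum_mod X Y, power_mod N 1) :=
  (pow_in N ord0 \o ((al \o ds_pr1 X Y) + (i \o ds_pr2 X Y)))%VF.
have hf : is_hom f.
  by apply: hom_comp; auto using hom_pow_in, hom_pr1, hom_pr2 with homdb.
have fE x y : pow_pr N ord0 (f (x, y)) = al x + i y.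
  by rewrite comp_lfunE pow_pr_in add_lfunE !comp_lfunE !lfun_ofE.
exists 1%N, Y; apply: (mod_isoP hf).
  case=> x y fxy; have := fE x y; rewrite fxy linear0 => /esym E0.
  have x0 : x = 0.
    have := congr1 be E0; rewrite linearD /= EE bi addr0 => ->.
    by rewrite linear0.
  by move: E0; rewrite x0 linear0 add0r => /mi ->.
move=> v; pose y := pow_pr N ord0 v.
have [z zE] : exists z, i z = y - al (be y).
  by apply: ex; rewrite linearB /= EE subrr.
exists (be y, z); apply/ffunP => j; rewrite (ord1 j).
by have := fE (be y) z; rewrite zE addrC subrK /y !lfun_ofE.
Qed.

Lemma thru_proj_lift X X' M N (f : 'Hom(X, X')) (p : 'Hom(M, N))
    (g : 'Hom(X', N)) :
  thru (@projective k A) f -> is_hom p -> epi p -> is_hom g ->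
  exists h : 'Hom(X, M), is_hom h /\ (p \o h = g \o f)%VF.
Proof.
move=> + hp ep hg; elim=> [|P al be f' pP hal hbe _ [h [hh hE]]].
  by exists 0; split; [exact: hom0|rewrite !comp_lfun0r].
have [u [hu uE]] := proj_lift pP hp ep (hom_comp hg hbe).
exists ((u \o al) + h)%VF; split; first by auto with homdb.
by rewrite !comp_lfunDr hE !comp_lfunA uE.
Qed.

Lemma projective_add X : inadd (@projective k A) X -> projective X.
Proof.
move=> pX M N p g hp /limg_fullP ep hg.
have [h [hh]] := thru_proj_lift pX hp ep hg.
by rewrite comp_lfun1r; exists h.
Qed.

Definition orb M (x : M) : 'Hom(regular_mod A, M) := lfun_of (act_linearl x).

Lemma orbE M (x : M) a : orb x a = act M a x.
Proof. exact: lfun_ofE. Qed.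

Lemma hom_orb M (x : M) : is_hom (orb x).
Proof. by move=> a b; rewrite !orbE /= actM. Qed.

Lemma orb1 M (f : 'Hom(regular_mod A, M)) : is_hom f -> f = orb (f 1).
Proof.
move=> hf; apply/lfunP => a; rewrite orbE -hf /=.
by rewrite -[LHS](congr1 f (mulr1 (a : A))).
Qed.

Lemma regular_projective : projective (regular_mod A).
Proof.
move=> M N p f hp /limg_fullP ep hf; have [m mE] := ep (f 1).
exists (orb m); split; first exact: hom_orb.
by apply/lfunP => a; rewrite comp_lfunE orbE hp mE (orb1 hf) !orbE act1.
Qed.

(** No minimality is intended: P is the free module on a k-basis of M. *)
Lemma proj_cover M : exists P (p : 'Hom(P, M)),
  [/\ projective P, is_hom p, epi p & inadd (eq (regular_mod A)) P].
Proof.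
pose n := \dim (fullv : {vspace M}).
pose p : 'Hom(power_mod (regular_mod A) n, M) :=
  (\sum_(i < n) (orb (vbasis (fullv : {vspace M}))`_i \o pow_pr (regular_mod A) i))%VF.
exists (power_mod (regular_mod A) n), p; split.
- apply: projective_add; apply: inadd_sub (inadd_power _ _) => _ <-.
  exact: regular_projective.
- by apply: hom_sum => i; apply: hom_comp; [exact: hom_orb|exact: hom_pow_pr].
- move=> x.
  exists [ffun i => (coord (vbasis (fullv : {vspace M})) i x) *: (1 : A)].
  rewrite sum_lfunE [RHS](coord_vbasis (memvf x)); apply: eq_bigr => i _.
  by rewrite comp_lfunE orbE lfun_ofE ffunE actZl act1.
- exact: inadd_power.
Qed.

Lemma proj_split P M (p : 'Hom(M, P)) :
  projective P -> is_hom p -> epi p ->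
  exists s : 'Hom(P, M), is_hom s /\ (p \o s = \1)%VF.
Proof. by move=> pP hp ep; apply: proj_lift (@hom_id _ _ _). Qed.

Lemma proj_inadd_regular P : projective P -> inadd (eq (regular_mod A)) P.
Proof.
move=> pP; have [F [p [_ hp ep aF]]] := proj_cover P.
have [s [hs ps]] := proj_split pP hp ep.
exact: inadd_retract hs hp ps aF.
Qed.

Lemma injective_add X : inadd (@injective_mod k A) X -> injective_mod X.
Proof.
move=> iX M N j f hj /lker_eq0P mj hf.
suff [g [hg E]] : exists g : 'Hom(N, X), is_hom g /\ (g \o j = \1 \o f)%VF.
  by exists g; rewrite E comp_lfun1l.
elim: iX => [|I al be f' iI hal hbe _ [h [hh hE]]].
  by exists 0; split; [exact: hom0|rewrite !comp_lfun0l].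
have [u [hu uE]] := inj_extend iI hj mj (hom_comp hal hf).
exists ((be \o u) + h)%VF; split; first by auto with homdb.
by rewrite !comp_lfunDl hE -!comp_lfunA uE.
Qed.

Lemma inj_split I M (j : 'Hom(I, M)) :
  injective_mod I -> is_hom j -> mono j ->
  exists r : 'Hom(M, I), is_hom r /\ (r \o j = \1)%VF.
Proof. by move=> iI hj mj; apply: inj_extend (@hom_id _ _ _). Qed.

Section DualMap.
Context (M : fdmod A) (l : 'Hom(M, k^o)).

Lemma dmap_linear1 (x : M) : linear (fun a : A => l (act M a x) : k^o).
Proof. by move=> c a b; rewrite actDl actZl linearP. Qed.

Lemma dmap_linear2 :
  linear (fun x : M => lfun_of (dmap_linear1 x) : dual_mod A).
Proof.
move=> c x y; apply/lfunP => a.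
by rewrite add_lfunE scale_lfunE !lfun_ofE actD actZr linearP.
Qed.

(** The homomorphism that corresponds to the functional [l] under Hom_A(M, D(A)) = Hom_k(M, k). *)
Definition dmap : 'Hom(M, dual_mod A) := lfun_of dmap_linear2.

Lemma dmapE x a : (dmap x : 'Hom(A, k^o)) a = l (act M a x).
Proof. by rewrite !lfun_ofE. Qed.

Lemma hom_dmap : is_hom dmap.
Proof.
move=> a x; apply/lfunP => b.
by rewrite dmapE /= comp_lfunE lfunE /= dmapE actM.
Qed.

End DualMap.

Lemma dual_ev1_linear :
  linear (fun u : dual_mod A => (u : 'Hom(A, k^o)) 1 : k^o).
Proof. by move=> c u v; rewrite add_lfunE scale_lfunE. Qed.

Definition dual_ev1 : 'Hom(dual_mod A, k^o) := lfun_of dual_ev1_linear.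

(** Maps into D(A) are functionals, by [dmap] and [dual_ev1], and functionals extend along [j]
    through its linear left inverse [j^-1]. *)
Lemma dual_injective : injective_mod (dual_mod A).
Proof.
move=> M N j f hj /eqP jK hf.
exists (dmap (dual_ev1 \o f \o j^-1)%VF); split; first exact: hom_dmap.
apply/lfunP => x; apply/lfunP => a; rewrite comp_lfunE dmapE -hj !comp_lfunE.
by rewrite lker0_lfunK // hf lfun_ofE /= comp_lfunE lfunE /= mul1r.
Qed.

(** The coordinate functionals of a k-basis give maps to D(A) that separate points. The embedding
    need not be essential; [envelope] repairs that. *)
Lemma inj_hull M : exists I (i : 'Hom(M, I)),
  [/\ injective_mod I, is_hom i, mono i & inadd (eq (dual_mod A)) I].
Proof.
pose n := \dim (fullv : {vspace M}).
pose l i : 'Hom(M, k^o) := linfun (coord (vbasis (fullv : {vspace M})) i : M -> k^o).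
have [g [hg gE]] := @to_power (dual_mod A) n M (fun i => dmap (l i))
  (fun i => hom_dmap _).
exists (power_mod (dual_mod A) n), g; split=> //; last exact: inadd_power.
  apply: injective_add; apply: inadd_sub (inadd_power _ _) => _ <-.
  exact: dual_injective.
move=> x gx0; rewrite (coord_vbasis (memvf x)) big1 // => i _.
have := dmapE (l i) x 1; rewrite -gE comp_lfunE gx0 linear0 lfunE /=.
by rewrite act1 lfunE /= => <-; rewrite scale0r.
Qed.

Definition cogenerated Q M :=
  forall x : M, (forall f : 'Hom(M, Q), is_hom f -> f x = 0) -> x = 0.

(** A k-basis of Hom_A(J, Q) already separates points, so J embeds in a finite power of Q, and
    injectivity splits the embedding. *)
Lemma inj_cogen_inadd J Q : injective_mod J -> cogenerated Q J -> inadd (eq Q) J.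
Proof.
move=> iJ cJ; pose b i := (vbasis (homv J Q))`_i.
have hb i : (i < \dim (homv J Q))%N -> is_hom (b i).
  by move=> lti; apply/homvP; rewrite vbasis_mem ?mem_nth ?size_tuple.
have [g [hg gE]] := @to_power Q (\dim (homv J Q)) J (fun i => b i)
  (fun i => hb i (ltn_ord i)).
have mg : mono g.
  move=> x gx0; apply: cJ => f /homvP /coord_vbasis ->.
  rewrite sum_lfunE big1 // => i _.
  have := gE i; rewrite /b scale_lfunE => <-.
  by rewrite comp_lfunE gx0 linear0 scaler0.
have [r [hr rg]] := inj_split iJ hg mg.
exact: inadd_retract hg hr rg (inadd_power _ _).
Qed.

Lemma cogenerated_mono Q M N (j : 'Hom(M, N)) :
  is_hom j -> mono j -> cogenerated Q N -> cogenerated Q M.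
Proof.
move=> hj mj cN x fx0; apply/mj/cN => f hf.
by rewrite -comp_lfunE; apply: fx0; apply: hom_comp.
Qed.

Lemma cogenerated_inadd Q M : inadd (eq Q) M -> cogenerated Q M.
Proof.
move=> aM x fx0; rewrite -[x](id_lfunE).
elim: aM => [|Z al be f' QZ hal hbe _ IH]; first by rewrite lfunE.
by subst Z; rewrite add_lfunE IH comp_lfunE fx0 // linear0 addr0.
Qed.

Lemma cogenerated_trans Q R0 M :
  cogenerated Q R0 -> cogenerated R0 M -> cogenerated Q M.
Proof.
move=> cR cM x fx0; apply: cM => g hg; apply: cR => f hf.
by rewrite -comp_lfunE; apply: fx0; apply: hom_comp.
Qed.

Lemma proj_ses_split X Y Z (i : 'Hom(X, Y)) (p : 'Hom(Y, Z)) :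
  ses i p -> projective Z ->
  exists r : 'Hom(Y, X), is_hom r /\ (r \o i = \1)%VF.
Proof.
move=> s pZ; have [u [hu pu]] := proj_split pZ (ses_homp s) (ses_epi s).
have hiD : is_hom (\1 - (u \o p))%VF.
  by apply: homB; [exact: hom_id|apply: hom_comp => //; exact: ses_homp s].
have [|r [hr rE]] := lift_mono (ses_homi s) (ses_mono s) hiD.
  move=> y; apply: (ses_ex s).
  rewrite add_lfunE opp_lfunE linearB /= id_lfunE comp_lfunE.
  by rewrite -[p (u _)]comp_lfunE pu id_lfunE subrr.
exists r; split=> //; apply/lfunP => x. apply: (mono_eq (ses_mono s)).
rewrite comp_lfunE -comp_lfunE rE add_lfunE opp_lfunE !id_lfunE comp_lfunE.
by rewrite (ses_pi s) linear0 subr0.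
Qed.

Lemma inj_ses_split X Y Z (i : 'Hom(X, Y)) (p : 'Hom(Y, Z)) :
  ses i p -> injective_mod X ->
  exists u : 'Hom(Z, Y), is_hom u /\ (p \o u = \1)%VF.
Proof.
move=> s iX; have [r [hr ri]] := inj_split iX (ses_homi s) (ses_mono s).
have hiD : is_hom (\1 - (i \o r))%VF.
  by apply: homB; [exact: hom_id|apply: hom_comp => //; exact: ses_homi s].
have [|u [hu uE]] := factor_epi (ses_homp s) (ses_epi s) hiD.
  move=> y /(ses_ex s)[x <-].
  rewrite add_lfunE opp_lfunE id_lfunE comp_lfunE.
  by rewrite -[r (i _)]comp_lfunE ri id_lfunE subrr.
exists u; split=> //; apply/lfunP => z; have [y <-] := ses_epi s z.
rewrite comp_lfunE -[u _]comp_lfunE uE add_lfunE opp_lfunE !id_lfunE comp_lfunE.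
by rewrite linearB /= (ses_pi s) subr0.
Qed.

End Thru.

(** * Vanishing of Ext *)

Section Vanishing.
Context (k : fieldType) (A : falgType k).
Implicit Types (M N W X Y Z P I J K Q V : fdmod A) (C D : fdmod A -> Prop).

Definition extends X Y (i : 'Hom(X, Y)) N :=
  forall h : 'Hom(X, N), is_hom h ->
  exists H : 'Hom(Y, N), is_hom H /\ (H \o i)%VF = h.

(* With K the syzygy of X, the condition [extends i N] says Ext^1(X, N) = 0; so
   for constant [Nc] this is Ext^j(X, N) = 0 for 1 <= j <= t and N in [Nc].
   The index of [Nc] counts down: [Nc s] is tested at Ext^(t - s). *)
Fixpoint van (Nc : nat -> fdmod A -> Prop) (t : nat) X : Prop :=
  if t is s.+1 then
    exists K P (i : 'Hom(K, P)) (p : 'Hom(P, X)),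
      [/\ projective P, ses i p, forall N, Nc s N -> extends i N & van Nc s K]
  else True.

Section Fixed.
Context (Nc : nat -> fdmod A -> Prop).

(* A map factoring through modules with vanishing Ext lifts to the syzygy as a
   map with the same property; for the identity of X the lift differs from the
   identity of K by a map through the projective P. *)
Lemma van_lift t X K P (i : 'Hom(K, P)) (p : 'Hom(P, X)) (f : 'Hom(X, X)) :
  projective P -> ses i p -> thru (van Nc t.+1) f ->
  exists (f1 : 'Hom(P, P)) (f0 : 'Hom(K, K)),
    [/\ is_hom f1, (p \o f1 = f \o p)%VF, (f1 \o i = i \o f0)%VF,
        thru (van Nc t) f0
      & forall N (h : 'Hom(K, N)), Nc t N -> is_hom h ->
        exists H : 'Hom(P, N), is_hom H /\ (H \o i)%VF = (h \o f0)%VF].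
Proof.
move=> pP s; elim=> [|Z al be g [K' [P' [i' [p' [pP' s' ext vK']]]]] hal hbe _].
  exists 0, 0; split; rewrite ?comp_lfun0r ?comp_lfun0l //.
  - exact: hom0.
  - exact: thru0.
  by move=> N h _ _; exists 0; rewrite comp_lfun0l comp_lfun0r; split=> //; exact: hom0.
case=> g1 [g0 [hg1 pg1 ig1 tg0 extg]].
have [hi hp mi ep pi ex] := s; have [hi' hp' mi' ep' pi' ex'] := s'.
have [a [ha pa]] := proj_lift pP hp' ep' (hom_comp hal hp).
have [b [hb pb]] := proj_lift pP' hp ep (hom_comp hbe hp').
have [|a0 [ha0 ia0]] := lift_mono hi' mi' (hom_comp ha hi).
  move=> x; apply: ex'; rewrite comp_lfunE -[p' _]comp_lfunE pa comp_lfunE.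
  by rewrite pi linear0.
have [|b0 [hb0 ib0]] := lift_mono hi mi (hom_comp hb hi').
  move=> x; apply: ex; rewrite comp_lfunE -[p _]comp_lfunE pb comp_lfunE.
  by rewrite pi' linear0.
exists ((b \o a) + g1)%VF, ((b0 \o a0) + g0)%VF; split.
- by auto with homdb.
- by rewrite comp_lfunDr comp_lfunDl pg1 comp_lfunA pb -comp_lfunA pa comp_lfunA.
- by rewrite comp_lfunDr comp_lfunDl ig1 comp_lfunA ib0 -!comp_lfunA ia0.
- exact: thruS.
move=> N h NcN hh; have [H [hH HE]] := ext N NcN _ (hom_comp hh hb0).
have [H' [hH' HE']] := extg N h NcN hh.
exists ((H \o a) + H')%VF; split; first by auto with homdb.
by rewrite comp_lfunDl comp_lfunDr HE' -comp_lfunA -ia0 comp_lfunA HE comp_lfunA.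
Qed.

Lemma zero_projective P : mod_zero P -> projective P.
Proof.
move=> P0 M N p f hp ep hf; exists 0; split; first exact: hom0.
by apply/lfunP => x; rewrite (P0 x) !linear0.
Qed.

Lemma van_proj t P : projective P -> van Nc t P.
Proof.
elim: t P => //= t IH P pP.
have [|K [i s]] := ses_ker (@hom_id _ _ P); first by move=> x; exists x; rewrite id_lfunE.
have K0 : mod_zero K.
  by move=> x; apply: (ses_mono s); rewrite -[LHS]id_lfunE (ses_pi s).
exists K, P, i, \1%VF; split=> //; last exact/IH/zero_projective.
move=> N _ h hh; exists 0; split; first exact: hom0.
by apply/lfunP => x; rewrite (K0 x) !linear0.
Qed.

(** Independence of the presentation and closure under add at once: 1 - [f1] lands in K, so [f0]
    differs from the identity of K by [u \o i], along which every map out of K extends to P. *)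
Lemma van_ses_aux t X K P (i : 'Hom(K, P)) (p : 'Hom(P, X)) :
  projective P -> ses i p -> inadd (van Nc t.+1) X ->
  (forall N, Nc t N -> extends i N) /\ inadd (van Nc t) K.
Proof.
move=> pP s vX; have [f1 [f0 [hf1 pf1 if0 tf0 ext]]] := van_lift pP s vX.
have [hi hp mi ep pi ex] := s.
have hD : is_hom (\1 - f1)%VF by apply: homB => //; apply: hom_id.
have [|u [hu iu]] := lift_mono hi mi hD.
  move=> x; apply: ex; rewrite add_lfunE opp_lfunE linearB /= id_lfunE.
  by rewrite -[p (f1 x)]comp_lfunE pf1 comp_lfun1l subrr.
have K1 : (\1 = (u \o i) + f0)%VF.
  apply/lfunP => x; apply: (mono_eq mi); rewrite add_lfunE linearD /= id_lfunE.
  rewrite -[i (f0 x)]comp_lfunE -if0 !comp_lfunE -[i (u _)]comp_lfunE iu.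
  by rewrite add_lfunE opp_lfunE id_lfunE subrK.
split=> [N NcN h hh|].
  have [H [hH HE]] := ext N h NcN hh.
  exists ((h \o u) + H)%VF; split; first by auto with homdb.
  by rewrite comp_lfunDl HE -comp_lfunA -comp_lfunDr -K1 comp_lfun1r.
by rewrite /inadd {1}K1; apply: thruS => //; apply: van_proj.
Qed.

Lemma van_add t X : inadd (van Nc t) X -> van Nc t X.
Proof.
elim: t X => // t IH X vX; have [P [p [pP hp ep _]]] := proj_cover X.
have [K [i s]] := ses_ker hp ep; have [ext vK] := van_ses_aux pP s vX.
by exists K, P, i, p; split=> //; apply: IH.
Qed.

Lemma van_ses t X K P (i : 'Hom(K, P)) (p : 'Hom(P, X)) :
  projective P -> ses i p -> van Nc t.+1 X ->
  (forall N, Nc t N -> extends i N) /\ van Nc t K.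
Proof.
move=> pP s /(@inadd_self _ _ (van Nc t.+1)) vX.
by have [ext /van_add] := van_ses_aux pP s vX.
Qed.

End Fixed.

Lemma van_add_target t X (Nc Nc' : nat -> fdmod A -> Prop) :
  (forall s N, Nc' s N -> inadd (Nc s) N) -> van Nc t X -> van Nc' t X.
Proof.
move=> NN; elim: t X => //= t IH X [K [P [i [p [pP s ext vK]]]]].
exists K, P, i, p; split=> //; last exact: IH.
move=> N /NN Nadd h hh.
suff [H [hH HE]] : exists H : 'Hom(P, N), is_hom H /\ (H \o i = \1 \o h)%VF.
  by exists H; rewrite HE comp_lfun1l.
elim: Nadd => [|Z al be f' cZ hal hbe _ [h' [hh' hE]]].
  by exists 0; split; [exact: hom0|rewrite !comp_lfun0l].
have [u [hu uE]] := ext _ cZ _ (hom_comp hal hh).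
exists ((be \o u) + h')%VF; split; first by auto with homdb.
by rewrite !comp_lfunDl hE -!comp_lfunA uE.
Qed.

(** The presentations behind the hypotheses for different [j] may differ; [van_ses] moves all of
    them to a common one. *)
Lemma van_inter t X T (Nc : T -> fdmod A -> Prop) :
  (forall j, van (fun _ => Nc j) t X) -> van (fun _ N => exists j, Nc j N) t X.
Proof.
elim: t X => //= t IH X vX; have [P [p [pP hp ep _]]] := proj_cover X.
have [K [i s]] := ses_ker hp ep.
have vj j := van_ses pP s (vX j).
exists K, P, i, p; split=> //; last by apply: IH => j; case: (vj j).
by move=> N [j NcN]; have [ext _] := vj j; apply: ext.
Qed.

(** Cuts a given resolution into short exact sequences: Z is the i-th syzygy, seen as the quotient
    of term i by the image of the next differential, and S is any property that passes to
    syzygies. *)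
Lemma resolution_syzygy X (R : proj_resolution X) (S : nat -> fdmod A -> Prop) :
  S 0%N X ->
  (forall i K P Z (j : 'Hom(K, P)) (p : 'Hom(P, Z)),
     projective P -> ses j p -> S i Z -> S i.+1 K) ->
  forall i, exists Z (q : 'Hom(pr_mod R i, Z)),
    [/\ is_hom q, epi q, forall x, q x = 0 <-> exists y, pr_d R i y = x & S i Z].
Proof.
move=> S0 Sstep; elim=> [|i [Z [q [hq eq ex SZ]]]].
  exists X, (pr_aug R); split=> //; first exact: pr_aug_hom.
    exact/limg_fullP/pr_aug_surj.
  move=> x; rewrite -limgP pr_exact0 memv_ker; split=> [->|/eqP//]; exact: eqxx.
have [K [j s]] := ses_ker hq eq.
have [|q' [hq' jq']] := lift_mono (ses_homi s) (ses_mono s) (@pr_d_hom _ _ _ R i).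
  by move=> x; apply: (ses_ex s); apply/ex; exists x.
exists K, q'; split=> //.
- move=> z; have /ex[y yE] := ses_pi s z; exists y.
  by apply: (mono_eq (ses_mono s)); rewrite -comp_lfunE jq'.
- move=> x; rewrite -limgP pr_exact memv_ker -jq' comp_lfunE; split.
    by move=> ->; rewrite linear0.
  by move=> /eqP/(ses_mono s).
- exact: Sstep (@pr_proj _ _ _ R i) s SZ.
Qed.

(** Degree i+1 is Ext^1 of the i-th syzygy Z: the cocycle kills the kernel of [pr_d R i], so it
    factors through the kernel K of [q], and from K it extends to term i. *)
Lemma van_cocycle X N (R : proj_resolution X) i (f : 'Hom(pr_mod R i.+1, N)) :
  (forall t, van (fun _ => eq N) t X) -> is_cocycle f -> is_coboundary f.
Proof.
move=> vX [hf fd].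
have [||Z [q [hq eq ex vZ]]] := @resolution_syzygy X R
  (fun _ Z => forall t, van (fun _ => eq N) t Z) _ _ i; first exact: vX.
  by move=> _ K P Z j p pP s vZ t; have [_] := van_ses pP s (vZ t.+1).
have [K [j s]] := ses_ker hq eq.
have [|q' [hq' jq']] := lift_mono (ses_homi s) (ses_mono s) (@pr_d_hom _ _ _ R i).
  by move=> x; apply: (ses_ex s); apply/ex; exists x.
have eq' : epi q'.
  move=> z; have /ex[y yE] := ses_pi s z; exists y.
  by apply: (mono_eq (ses_mono s)); rewrite -comp_lfunE jq'.
have [|g [hg gq']] := factor_epi hq' eq' hf.
  move=> x qx0; have : x \in lker (pr_d R i).
    by rewrite memv_ker -jq' comp_lfunE qx0 linear0.
  by rewrite -pr_exact => /limgP[y <-]; rewrite -comp_lfunE fd lfunE.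
have [ext _] := van_ses (@pr_proj _ _ _ R i) s (vZ 1%N).
have [H [hH HE]] := ext N erefl g hg.
by exists H; split=> //; rewrite -jq' comp_lfunA HE.
Qed.

Record proj_presentation X := ProjPresentation {
  cov_ker : fdmod A;
  cov_mod : fdmod A;
  cov_i : 'Hom(cov_ker, cov_mod);
  cov_p : 'Hom(cov_mod, X);
  cov_proj : projective cov_mod;
  cov_ses : ses cov_i cov_p
}.

Lemma proj_presentation_exists X : exists c : proj_presentation X, True.
Proof.
have [P [p [pP hp ep _]]] := proj_cover X; have [K [i s]] := ses_ker hp ep.
by exists (ProjPresentation pP s).
Qed.

Lemma proj_resolution_exists X : exists R : proj_resolution X, True.
Proof.
pose c Y : proj_presentation Y := projT1 (cid (proj_presentation_exists Y)).
pose Z n := iter n (fun Y => cov_ker (c Y)) X.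
pose d n : 'Hom(cov_mod (c (Z n.+1)), cov_mod (c (Z n))) :=
  (cov_i (c (Z n)) \o cov_p (c (Z n.+1)))%VF.
have im n : limg (d n) = lker (cov_p (c (Z n))).
  apply/vspaceP => x; apply/idP/idP.
    move=> /limgP[y <-]; rewrite memv_ker comp_lfunE.
    by rewrite (ses_pi (cov_ses (c (Z n)))).
  rewrite memv_ker => /eqP/(ses_ex (cov_ses (c (Z n))))[z zE].
  apply/limgP; have [y yE] := ses_epi (cov_ses (c (Z n.+1))) z.
  by exists y; rewrite comp_lfunE yE.
have ker n : lker (d n) = lker (cov_p (c (Z n.+1))).
  apply/vspaceP => x; rewrite !memv_ker comp_lfunE; apply/eqP/eqP => [|->].
    by move/(ses_mono (cov_ses (c (Z n)))).
  by rewrite linear0.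
unshelve eexists (@ProjResolution k A X (fun n => cov_mod (c (Z n)))
  (cov_p (c X)) d _ _ _ _ _ _) => //.
- by move=> n; apply: cov_proj.
- exact: ses_homp (cov_ses (c X)).
- move=> n; apply: hom_comp; first exact: ses_homi (cov_ses (c (Z n))).
  exact: ses_homp (cov_ses (c (Z n.+1))).
- exact/limg_fullP/ses_epi/cov_ses.
- by move=> n; rewrite im ker.
Qed.

Lemma van_Ext_zero X N i : (0 < i)%N -> (forall t, van (fun _ => eq N) t X) ->
  Ext_zero i X N.
Proof.
case: i => // i _ vX; have [R _] := proj_resolution_exists X.
by exists R => f; apply: van_cocycle.
Qed.

End Vanishing.

Lemma ele_esup (S : enat -> Prop) x : S x -> ele x (esup S).
Proof.
move=> Sx; case E: (esup S) => [n|]; last by case: x {Sx}.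
by have [/(_ x Sx)] := (eleastP _ _).1 E.
Qed.

Lemma esup_le (S : enat -> Prop) n :
  (forall x, S x -> ele x (Fin n)) -> ele (esup S) (Fin n).
Proof.
move=> Sn; have : efinite (esup S) by apply/esup_finiteP; exists n.
case E: (esup S) => [m|] //= _.
by have [_ /(_ n Sn)] := (eleastP _ _).1 E.
Qed.

(** * Injective envelopes and dominant dimension *)

Section Envelopes.
Context (k : fieldType) (A : falgType k).
Implicit Types (M N W X Y Z P I J K Q V C E : fdmod A).

Definition mdim M := \dim (fullv : {vspace M}).

Lemma mono_mdim X Y (f : 'Hom(X, Y)) : mono f -> (mdim X <= mdim Y)%N.
Proof.
move=> /lker_eq0P fK; rewrite /mdim -(@limg_dim_eq _ _ _ f fullv) ?fK ?capv0 //.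
by rewrite dimvS ?subvf.
Qed.

Lemma mono_epi X Y (f : 'Hom(X, Y)) :
  mono f -> (mdim Y <= mdim X)%N -> epi f.
Proof.
move=> /lker_eq0P fK le; apply/limg_fullP/eqP; rewrite eqEdim subvf /=.
by rewrite (@limg_dim_eq _ _ _ f fullv) ?fK ?capv0.
Qed.

Lemma epi_mono X Y (f : 'Hom(X, Y)) :
  epi f -> (mdim X <= mdim Y)%N -> mono f.
Proof.
move=> /limg_fullP fI le; apply/lker_eq0P/eqP; rewrite -dimv_eq0.
have := limg_ker_dim f fullv; rewrite fI -/(mdim X) -/(mdim Y) capfv => E.
by move: le; rewrite -E -{2}[mdim Y]add0n leq_add2r leqn0.
Qed.

(** Essentiality tested on maps rather than submodules, so that it composes and applies directly to
    extended maps; [essm_essential] recovers [essential]. *)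
Definition essm X Y (i : 'Hom(X, Y)) :=
  forall Z (f : 'Hom(Y, Z)), is_hom f -> mono (f \o i)%VF -> mono f.

Lemma essm_essential X Y (i : 'Hom(X, Y)) :
  mono i -> essm i -> essential (limg i).
Proof.
move=> mi ei U hU U0 iU0; apply: U0; have s := ses_quo hU.
apply/eqP; rewrite -subv0; apply/subvP => x xU; rewrite memv0; apply/eqP.
apply: (ei _ _ (ses_homp s)); last exact/quo_pi0.
move=> z; rewrite comp_lfunE => /quo_pi0 izU.
have : i z \in (limg i :&: U)%VS by rewrite memv_cap izU memv_img ?memvf.
by rewrite iU0 memv0 => /eqP/mi.
Qed.

Lemma ex_max (T : Type) (P : T -> Prop) (f : T -> nat) b :
  (exists x, P x) -> (forall x, P x -> (f x <= b)%N) ->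
  exists x, P x /\ forall y, P y -> (f y <= f x)%N.
Proof.
move=> [x0 Px0] Pb; pose Q n := `[< exists x, P x /\ f x = n >].
have exQ : exists n, Q n by exists (f x0); apply/asboolP; exists x0.
have Qb n : Q n -> (n <= b)%N by move=> /asboolP[x [/Pb + <-]].
case: (ex_maxnP exQ Qb) => m /asboolP[x [Px fx]] maxm.
by exists x; split=> // y Py; rewrite fx; apply: maxm; apply/asboolP; exists y.
Qed.

(* In an injective module J containing X, take an essential extension V of X of
   maximal dimension, then a smallest quotient B of J into which V embeds.
   Then V -> B is essential and B embeds back into J, so V = B is a direct
   summand of J. *)
Lemma envelope X : exists I C (i : 'Hom(X, I)) (p : 'Hom(I, C)),
  [/\ injective_mod I, ses i p & essm i].
Proof.
have [J [j0 [iJ hj0 mj0 _]]] := inj_hull X.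
pose T := {V : fdmod A & ('Hom(X, V) * 'Hom(V, J))%type}.
pose P (u : T) := let: existT V (i, j) := u in
  [/\ is_hom i, essm i, is_hom j, mono j & (j \o i)%VF = j0].
have [||[V [i j]] [[hi ei hj mj ji] maxV]] :=
  @ex_max T P (fun u => mdim (projT1 u)) (mdim J).
- exists (existT _ X (\1%VF, j0)); split=> //; first exact: hom_id.
    by move=> Z f _; rewrite comp_lfun1r.
  by rewrite comp_lfun1r.
- by case=> V [i j] [_ _ _ mj _]; apply: mono_mdim mj.
pose S := {B : fdmod A & 'Hom(J, B)}.
pose R (u : S) := let: existT B q := u in
  [/\ is_hom q, epi q & mono (q \o j)%VF].
have [||[B q] [[hq eq mqj] minB]] :=
  @ex_max S R (fun u => mdim J - mdim (projT1 u))%N (mdim J).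
- exists (existT _ J \1%VF); split; [exact: hom_id| |by rewrite comp_lfun1l].
  by move=> x; exists x; rewrite id_lfunE.
- by move=> u _; apply: leq_subr.
have le_epi Y Z (f : 'Hom(Y, Z)) : epi f -> (mdim Z <= mdim Y)%N.
  move=> /limg_fullP fI; rewrite /mdim -fI.
  by rewrite -(limg_ker_dim f fullv) leq_addl.
have eqj : essm (q \o j)%VF.
  move=> Y f hf mf; have [Z [p [u [hp hu ep mu fE]]]] := image_factor hf.
  suff mp : mono p by move=> x; rewrite -fE comp_lfunE => /mu/mp.
  apply: (epi_mono ep).
  have := minB (existT _ Z (p \o q)%VF); rewrite /= leq_sub2lE; last exact: le_epi eq.
  apply; split; first exact: hom_comp.
    by move=> z; have [b <-] := ep z; have [x <-] := eq b; exists x; rewrite comp_lfunE.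
  move=> x E0; apply: mf; rewrite -fE comp_lfunE comp_lfunE.
  by move: E0; rewrite !comp_lfunE => ->; rewrite linear0.
have hqj := hom_comp hq hj.
have [g [hg gE]] := inj_extend iJ hqj mqj hj.
have mg : mono g by apply: eqj => //; rewrite gE.
have leB : (mdim B <= mdim V)%N.
  apply: (maxV (existT _ B ((q \o j \o i)%VF, g))); split=> //.
  - exact: hom_comp.
  - move=> Z f hf; rewrite comp_lfunA => /(ei _ _ (hom_comp hf hqj)).
    exact: eqj.
  - by rewrite comp_lfunA gE.
have [r [hr _ rK]] := bij_hom_inv hqj mqj (mono_epi mqj leB).
have mi : mono i.
  by move=> x x0; apply: mj0; rewrite -ji comp_lfunE x0 linear0.
have [C [p s]] := ses_coker hi mi.
exists V, C, i, p; split=> //.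
apply: injective_add; apply: (inadd_retract (al := j) (be := (r \o q)%VF)) => //.
- exact: hom_comp.
- by rewrite -comp_lfunA.
- exact: inadd_self.
Qed.

Definition projinj X := injective_mod X /\ projective X.

(* dominant dimension at least t, without minimality of the resolution *)
Fixpoint dd t X : Prop :=
  if t is s.+1 then
    exists J C (i : 'Hom(X, J)) (p : 'Hom(J, C)), [/\ projinj J, ses i p & dd s C]
  else True.

Lemma zero_injective X : mod_zero X -> injective_mod X.
Proof.
move=> X0 M N j f hj _ hf; exists 0; split; first exact: hom0.
by apply/lfunP => x; rewrite [LHS]X0 [RHS]X0.
Qed.

Lemma dd_projinj t J : projinj J -> dd t J.
Proof.
elim: t J => //= t IH J pJ.
have m1 : mono (\1%VF : 'Hom(J, J)) by move=> x; rewrite id_lfunE.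
have [C [p s]] := ses_coker (@hom_id _ _ J) m1.
have C0 : mod_zero C.
  by move=> y; have [x <-] := ses_epi s y; rewrite -[x]id_lfunE (ses_pi s).
exists J, C, \1%VF, p; split=> //; apply: IH; split.
  exact: zero_injective.
exact: zero_projective.
Qed.

Lemma dd_leq s t X : (s <= t)%N -> dd t X -> dd s X.
Proof.
elim: s t X => // s IH [|t] X //= le_st [J [C [i [p [pJ ss dC]]]]].
by exists J, C, i, p; split=> //; apply: IH dC.
Qed.

(** Dual to [van_lift], with one gain: [f1] goes through projectives, because the modules J that it
    passes are projective as well as injective. *)
Lemma dd_lift t X E C (i : 'Hom(X, E)) (p : 'Hom(E, C)) (f : 'Hom(X, X)) :
  injective_mod E -> ses i p -> thru (dd t.+1) f ->
  exists (f1 : 'Hom(E, E)) (f0 : 'Hom(C, C)),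
    [/\ thru (@projective k A) f1, thru (dd t) f0, (f1 \o i = i \o f)%VF
      & (p \o f1 = f0 \o p)%VF].
Proof.
move=> iE s; elim=> [|Z al be g [J [C' [i' [p' [[iJ pJ] s' dC']]]]] hal hbe _].
  exists 0, 0; split; rewrite ?comp_lfun0r ?comp_lfun0l //; exact: thru0.
case=> g1 [g0 [tg1 tg0 ig1 pg1]].
have [hi hp mi ep pi ex] := s; have [hi' hp' mi' ep' pi' ex'] := s'.
have [a [ha ai]] := inj_extend iJ hi mi (hom_comp hi' hal).
have [b [hb bi]] := inj_extend iE hi' mi' (hom_comp hi hbe).
have [|a0 [ha0 a0p]] := factor_epi hp ep (hom_comp hp' ha).
  move=> x /ex[y <-].
  by rewrite comp_lfunE -[a _]comp_lfunE ai comp_lfunE pi'.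
have [|b0 [hb0 b0p]] := factor_epi hp' ep' (hom_comp hp hb).
  move=> x /ex'[y <-].
  by rewrite comp_lfunE -[b _]comp_lfunE bi comp_lfunE pi.
exists ((b \o a) + g1)%VF, ((b0 \o a0) + g0)%VF; split.
- exact: thruS.
- exact: thruS.
- by rewrite comp_lfunDl comp_lfunDr ig1 -comp_lfunA ai comp_lfunA bi comp_lfunA.
- by rewrite comp_lfunDl comp_lfunDr pg1 comp_lfunA -b0p -!comp_lfunA a0p.
Qed.

(** [f1] extends the identity of X, so it is injective by essentiality and hence an automorphism of
    E; as it goes through projectives, E is projective. Since 1 - [f1] kills X, [f0] differs from
    the identity of C by a map through E. *)
Lemma dd_env_aux t X E C (i : 'Hom(X, E)) (p : 'Hom(E, C)) :
  injective_mod E -> ses i p -> essm i -> inadd (dd t.+1) X ->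
  projective E /\ inadd (dd t) C.
Proof.
move=> iE s ei dX; have [f1 [f0 [tf1 tf0 f1i pf1]]] := dd_lift iE s dX.
have hf1 := thru_hom tf1; have [hi hp mi ep pi ex] := s.
rewrite comp_lfun1r in f1i.
have mf1 : mono f1 by apply: ei => //; rewrite f1i.
have [u [hu _ uf1]] := bij_hom_inv hf1 mf1 (mono_epi mf1 (leqnn _)).
have pE : projective E.
  by apply: projective_add; rewrite /inadd -uf1; apply: thru_compl.
have hD : is_hom (\1 - f1)%VF by apply: homB => //; apply: hom_id.
have [|v [hv vp]] := factor_epi hp ep hD.
  move=> x /ex[y <-]; rewrite add_lfunE opp_lfunE id_lfunE.
  by rewrite -[f1 _]comp_lfunE f1i subrr.
split=> //; rewrite /inadd.
have -> : (\1 = (p \o v) + f0)%VF.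
  apply/lfunP => c; have [x <-] := ep c.
  rewrite add_lfunE id_lfunE -[f0 _]comp_lfunE -pf1 !comp_lfunE.
  by rewrite -[v _]comp_lfunE vp -linearD /= add_lfunE opp_lfunE id_lfunE subrK.
by apply: thruS => //; apply: dd_projinj.
Qed.

Lemma dd_add t X : inadd (dd t) X -> dd t X.
Proof.
elim: t X => // t IH X dX; have [E [C [i [p [iE s ei]]]]] := envelope X.
have [pE dC] := dd_env_aux iE s ei dX.
by exists E, C, i, p; split=> //; apply: IH.
Qed.

Lemma dd_env t X E C (i : 'Hom(X, E)) (p : 'Hom(E, C)) :
  injective_mod E -> ses i p -> essm i -> dd t.+1 X -> projective E /\ dd t C.
Proof.
move=> iE s ei /(@inadd_self _ _ (dd t.+1)) dX.
by have [pE /dd_add] := dd_env_aux iE s ei dX.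
Qed.

Record inj_presentation X := InjPresentation {
  env_mod : fdmod A;
  env_coker : fdmod A;
  env_i : 'Hom(X, env_mod);
  env_p : 'Hom(env_mod, env_coker);
  env_inj : injective_mod env_mod;
  env_ses : ses env_i env_p;
  env_ess : essm env_i
}.

Lemma inj_presentation_exists X : exists e : inj_presentation X, True.
Proof.
by have [E [C [i [p [iE s ei]]]]] := envelope X; exists (InjPresentation iE s ei).
Qed.

Lemma dd_minimal t X : dd t X ->
  exists R : inj_resolution X,
    minimal_ir R /\ forall i, (i < t)%N -> projective (ir_mod R i).
Proof.
move=> dX; pose c Y : inj_presentation Y := projT1 (cid (inj_presentation_exists Y)).
pose Z n := iter n (fun Y => env_coker (c Y)) X.
pose d n : 'Hom(env_mod (c (Z n)), env_mod (c (Z n.+1))) :=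
  (env_i (c (Z n.+1)) \o env_p (c (Z n)))%VF.
have im n : limg (d n) = limg (env_i (c (Z n.+1))).
  apply/vspaceP => x; apply/idP/idP => /limgP[y <-]; apply/limgP.
    by exists (env_p (c (Z n)) y); rewrite comp_lfunE.
  have [z <-] := ses_epi (env_ses (c (Z n))) y.
  by exists z; rewrite comp_lfunE.
have ker n : limg (env_i (c (Z n))) = lker (d n).
  apply/vspaceP => x; rewrite memv_ker comp_lfunE; apply/idP/idP.
    by move=> /limgP[y <-]; rewrite (ses_pi (env_ses (c (Z n)))) linear0.
  move=> /eqP/(ses_mono (env_ses (c (Z n.+1)))).
  by move/(ses_ex (env_ses (c (Z n)))) => [y yE]; apply/limgP; exists y.
unshelve eexists (@InjResolution k A X (fun n => env_mod (c (Z n)))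
  (env_i (c X)) d _ _ _ _ _ _) => //.
- by move=> n; apply: env_inj.
- exact: ses_homi (env_ses (c X)).
- move=> n; apply: hom_comp; first exact: ses_homi (env_ses (c (Z n.+1))).
  exact: ses_homp (env_ses (c (Z n))).
- exact/lker_eq0P/ses_mono/env_ses.
- by move=> n; rewrite im ker.
split; first split=> [|n] /=.
- by apply: essm_essential; [exact/ses_mono/env_ses|exact: env_ess].
- by rewrite im; apply: essm_essential; [exact/ses_mono/env_ses|exact: env_ess].
move=> n lt_nt /=.
(* Each envelope uses up one unit of [dd]: the n-th cosyzygy keeps the remaining s = t - n. *)
suff {lt_nt n} H s n : dd (n + s) X -> dd s (Z n).
  have := H (t - n)%N n; rewrite subnKC ?(ltnW lt_nt) // => /(_ dX).
  rewrite -(subnSK lt_nt).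
  move=> /(dd_env (@env_inj _ (c (Z n))) (env_ses _) (@env_ess _ (c (Z n)))).
  by case.
elim: n s => [|n IH] s; first by rewrite add0n.
rewrite addSnnS => /IH.
by case/(dd_env (@env_inj _ (c (Z n))) (env_ses _) (@env_ess _ (c (Z n)))).
Qed.

Lemma resolution_dd t X (R : inj_resolution X) :
  (forall i, (i < t)%N -> projective (ir_mod R i)) -> dd t X.
Proof.
move=> pR.
suff H s n Z (j : 'Hom(Z, ir_mod R n)) :
    (n + s = t)%N -> is_hom j -> mono j -> limg j = lker (ir_d R n) -> dd s Z.
  apply: (H t 0%N X (ir_aug R)) => //; first exact: ir_aug_hom.
    exact/lker_eq0P/ir_aug_inj.
  exact: ir_exact0.
elim: s n Z j => //= s IH n Z j nst hj mj jE.
have [C [p sp]] := ses_coker hj mj; have [_ hp _ ep pj ex] := sp.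
have [|u [hu up]] := factor_epi hp ep (@ir_d_hom _ _ _ R n).
  move=> x /ex[z <-]; apply/eqP; rewrite -memv_ker -jE.
  by apply/limgP; exists z.
exists (ir_mod R n), C, j, p; split=> //.
  split; first exact: ir_inj.
  by apply: pR; rewrite -nst -addSnnS leq_addr.
apply: (IH n.+1 C u) => //; first by rewrite addSnnS.
- move=> c; have [x <-] := ep c; rewrite -comp_lfunE up => /eqP.
  by rewrite -memv_ker -jE => /limgP[z <-].
- rewrite -ir_exact; apply/vspaceP => x; apply/idP/idP => /limgP[y <-].
    by have [z <-] := ep y; rewrite -comp_lfunE up; apply/limgP; exists z.
  by rewrite -up comp_lfunE; apply/limgP; exists (p y).
Qed.

(** [domdim] asks for a minimal resolution and [dd] does not; [dd_minimal] and [resolution_dd]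
    bridge the two. *)
Lemma domdimP t : ele (Fin t) (domdim A) <-> dd t (regular_mod A).
Proof.
split=> [|/dd_minimal[R [mR pR]]]; last by apply: ele_esup; exists t, R.
case: t => // t le_t; apply: contrapT => nd.
(* If [dd] fails at t+1, no resolution starts with more than t projective terms, so the supremum is
   at most t. *)
suff : ele (domdim A) (Fin t) by case: (domdim A) le_t => //= n; rewrite ltnNge => /negP.
apply: esup_le => _ [s [R [-> _ pR]]] /=; rewrite leqNgt; apply/negP => lt_ts.
apply: nd; apply: (resolution_dd (R := R)) => i lt_it.
by apply: pR; apply: leq_trans lt_it lt_ts.
Qed.

End Envelopes.

(** * Commuting actions and Mueller's theorem *)

(* Both actions are left actions; [modr] is the module over E. *)
Record bimod (k : fieldType) (A E : falgType k) := Bimod {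
  bcar :> vectType k;
  actl : A -> bcar -> bcar;
  actr : E -> bcar -> bcar;
  actl_linear : forall a, linear (actl a);
  actl_linearl : forall x, linear (actl^~ x);
  actl1 : forall x, actl 1 x = x;
  actlM : forall a b x, actl (a * b) x = actl a (actl b x);
  actr_linear : forall e, linear (actr e);
  actr_linearl : forall x, linear (actr^~ x);
  actr1 : forall x, actr 1 x = x;
  actrM : forall d e x, actr (d * e) x = actr d (actr e x);
  actlr : forall a e x, actl a (actr e x) = actr e (actl a x)
}.

Definition modl (k : fieldType) (A E : falgType k) (B : bimod A E) : fdmod A :=
  FdMod (@actl_linear _ _ _ B) (@actl_linearl _ _ _ B) (@actl1 _ _ _ B)
    (@actlM _ _ _ B).

Definition bswap (k : fieldType) (A E : falgType k) (B : bimod A E) : bimod E A :=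
  Bimod (@actr_linear _ _ _ B) (@actr_linearl _ _ _ B) (@actr1 _ _ _ B)
    (@actrM _ _ _ B) (@actl_linear _ _ _ B) (@actl_linearl _ _ _ B)
    (@actl1 _ _ _ B) (@actlM _ _ _ B)
    (fun e a x => esym (actlr a e x)).

Definition modr (k : fieldType) (A E : falgType k) (B : bimod A E) : fdmod E :=
  modl (bswap B).

Arguments modl : simpl never.
Arguments modr : simpl never.

(** * The contravariant functor Hom_A(-, B) from A-modules to E-modules *)

Section HomFunctor.
Context (k : fieldType) (A E : falgType k) (B : bimod A E).
Implicit Types (X Y Z P K J : fdmod A) (C : fdmod A -> Prop).

Lemma actlrC a e (x : B) :
  act (modl B) a (act (modr B) e x) = act (modr B) e (act (modl B) a x).
Proof. exact: actlr. Qed.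

Lemma ract_subproof e : linear (act (modr B) e : modl B -> modl B).
Proof. exact: actr_linear. Qed.

Definition ract (e : E) : 'Hom(modl B, modl B) := lfun_of (ract_subproof e).

Lemma ractE e x : ract e x = act (modr B) e x.
Proof. exact: lfun_ofE. Qed.

Lemma hom_ract e : is_hom (ract e).
Proof. by move=> a x; rewrite !ractE actlrC. Qed.

Section Object.
Context (X : fdmod A).

Lemma Hm_act_subproof e (u : subvs_of (homv X (modl B))) :
  (ract e \o vsval u)%VF \in homv X (modl B).
Proof.
apply/homvP; apply: hom_comp; first exact: hom_ract.
exact/homvP/subvsP.
Qed.

Definition Hm_act e u := Subvs (Hm_act_subproof e u).

Definition Hm : fdmod E.
Proof.
refine (@FdMod k E (subvs_of (homv X (modl B))) Hm_act _ _ _ _).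
- by move=> e c u v; apply/val_inj; rewrite /= comp_lfunDr comp_lfunZr.
- move=> u c d e; apply/val_inj/lfunP => x.
  rewrite /= add_lfunE scale_lfunE !comp_lfunE !ractE.
  by rewrite actDl actZl.
- by move=> u; apply/val_inj/lfunP => x; rewrite /= comp_lfunE ractE act1.
- move=> d e u; apply/val_inj/lfunP => x.
  by rewrite /= !comp_lfunE !ractE actM.
Defined.

Definition hval (u : Hm) : 'Hom(X, modl B) := locked (vsval (u : subvs_of _)).

Lemma hom_hval u : is_hom (hval u).
Proof. by rewrite /hval -lock; apply/homvP/subvsP. Qed.

Lemma hval_inj u v : hval u = hval v -> u = v.
Proof. by rewrite /hval -!lock; apply: val_inj. Qed.

Lemma hval_act e u x : hval (act Hm e u) x = act (modr B) e (hval u x).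
Proof. by rewrite /hval -!lock /= comp_lfunE ractE. Qed.

Lemma hvalP c u v : hval (c *: u + v) = c *: hval u + hval v.
Proof. by rewrite /hval -!lock. Qed.

Lemma hvalD u v : hval (u + v) = hval u + hval v.
Proof. by rewrite /hval -!lock. Qed.

Lemma hval0 : hval 0 = 0.
Proof. by rewrite /hval -!lock. Qed.

Definition hmk (f : 'Hom(X, modl B)) : Hm := vsproj (homv X (modl B)) f.

Lemma hmkK f : is_hom f -> hval (hmk f) = f.
Proof. by move=> hf; rewrite /hval -lock; apply/vsprojK/homvP. Qed.

Lemma hmkP c f g : hmk (c *: f + g) = c *: hmk f + hmk g.
Proof. exact: linearP. Qed.

End Object.

Lemma Hmap_linear X Y (f : 'Hom(X, Y)) :
  linear (fun u : Hm Y => hmk (hval u \o f)%VF).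
Proof. by move=> c u v; rewrite hvalP comp_lfunDl -comp_lfunZl hmkP. Qed.

Definition Hmap X Y (f : 'Hom(X, Y)) : 'Hom(Hm Y, Hm X) := lfun_of (Hmap_linear f).

Lemma HmapE X Y (f : 'Hom(X, Y)) u : is_hom f -> hval (Hmap f u) = (hval u \o f)%VF.
Proof.
move=> hf; rewrite lfun_ofE hmkK //; apply: hom_comp => //; exact: hom_hval.
Qed.

Lemma hom_Hmap X Y (f : 'Hom(X, Y)) : is_hom f -> is_hom (Hmap f).
Proof.
move=> hf e u; apply/hval_inj/lfunP => x.
by rewrite hval_act !HmapE // !comp_lfunE hval_act.
Qed.

Lemma Hmap1 X : Hmap (\1%VF : 'Hom(X, X)) = \1%VF.
Proof.
apply/lfunP => u; apply/hval_inj; rewrite HmapE; last exact: hom_id.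
by rewrite comp_lfun1r id_lfunE.
Qed.

Lemma Hmap0 X Y : Hmap (0 : 'Hom(X, Y)) = 0.
Proof.
apply/lfunP => u; apply/hval_inj; rewrite HmapE; last exact: hom0.
by rewrite comp_lfun0r lfunE hval0.
Qed.

Lemma HmapD X Y (f g : 'Hom(X, Y)) :
  is_hom f -> is_hom g -> Hmap (f + g) = Hmap f + Hmap g.
Proof.
move=> hf hg; apply/lfunP => u; apply/hval_inj.
by rewrite add_lfunE hvalD !HmapE ?comp_lfunDr //; apply: homD.
Qed.

Lemma Hmap_comp X Y Z (f : 'Hom(X, Y)) (g : 'Hom(Y, Z)) :
  is_hom f -> is_hom g -> Hmap (g \o f)%VF = (Hmap f \o Hmap g)%VF.
Proof.
move=> hf hg; apply/lfunP => u; apply/hval_inj; rewrite comp_lfunE.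
by rewrite !HmapE ?comp_lfunA //; apply: hom_comp.
Qed.

Lemma thru_Hmap C (D : fdmod E -> Prop) X Y (f : 'Hom(X, Y)) :
  (forall Z, C Z -> inadd D (Hm Z)) -> thru C f -> thru D (Hmap f).
Proof.
move=> CD; elim=> [|Z al be g CZ hal hbe tg IH]; first by rewrite Hmap0; apply: thru0.
have hg := thru_hom tg.
rewrite HmapD ?Hmap_comp //; last exact: hom_comp.
apply: thruD => //; have := thru_comp2 (hom_Hmap hbe) (hom_Hmap hal) (CD _ CZ).
by rewrite comp_lfun1r.
Qed.

Lemma inadd_Hm C (D : fdmod E -> Prop) X :
  (forall Z, C Z -> inadd D (Hm Z)) -> inadd C X -> inadd D (Hm X).
Proof. by move=> CD /(thru_Hmap CD); rewrite Hmap1. Qed.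

Lemma Hmap_mono X Y (p : 'Hom(X, Y)) : is_hom p -> epi p -> mono (Hmap p).
Proof.
move=> hp ep u pu0; apply/hval_inj/lfunP => y; have [x <-] := ep y.
by rewrite -comp_lfunE -HmapE // pu0 !hval0 !lfunE.
Qed.

Lemma Hmap_exact X Y Z (i : 'Hom(X, Y)) (p : 'Hom(Y, Z)) v :
  ses i p -> Hmap i v = 0 -> exists u, Hmap p u = v.
Proof.
case=> hi hp mi ep pi ex iv0.
have [|g [hg gE]] := factor_epi hp ep (hom_hval v).
  by move=> y /ex[x <-]; rewrite -comp_lfunE -HmapE // iv0 hval0 lfunE.
by exists (hmk g); apply/hval_inj; rewrite HmapE // hmkK.
Qed.

Lemma Hmap_comp0 X Y Z (i : 'Hom(X, Y)) (p : 'Hom(Y, Z)) u :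
  ses i p -> Hmap i (Hmap p u) = 0.
Proof.
case=> hi hp mi ep pi ex; apply/hval_inj; rewrite !HmapE // -comp_lfunA.
by apply/lfunP => x; rewrite !comp_lfunE pi linear0 hval0 lfunE.
Qed.

Lemma Hmap_epi X Y (i : 'Hom(X, Y)) :
  is_hom i -> extends i (modl B) -> epi (Hmap i).
Proof.
move=> hi ext v; have [H [hH HE]] := ext _ (hom_hval v).
by exists (hmk H); apply/hval_inj; rewrite HmapE // hmkK.
Qed.

Lemma ses_Hmap X Y Z (i : 'Hom(X, Y)) (p : 'Hom(Y, Z)) :
  ses i p -> extends i (modl B) -> ses (Hmap p) (Hmap i).
Proof.
move=> s ext; split.
- exact/hom_Hmap/ses_homp/s.
- exact/hom_Hmap/ses_homi/s.
- exact: Hmap_mono (ses_homp s) (ses_epi s).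
- exact: Hmap_epi (ses_homi s) ext.
- by move=> u; apply: Hmap_comp0 s.
- by move=> v; apply: Hmap_exact s.
Qed.

Lemma Hev_linear X (x : X) : linear (fun u : Hm X => hval u x : modr B).
Proof. by move=> c u v; rewrite hvalP add_lfunE scale_lfunE. Qed.

Definition Hev X (x : X) : 'Hom(Hm X, modr B) := lfun_of (Hev_linear x).

Lemma HevE X (x : X) u : Hev x u = hval u x.
Proof. exact: lfun_ofE. Qed.

Lemma hom_Hev X (x : X) : is_hom (Hev x).
Proof. by move=> e u; rewrite !HevE hval_act. Qed.

Lemma Hm_orb_linear :
  linear (fun x : modr B => hmk (@orb _ _ (modl B) x) : Hm (regular_mod A)).
Proof.
move=> c x y; rewrite -hmkP; congr hmk; apply/lfunP => a.
by rewrite add_lfunE scale_lfunE !orbE act_linear.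
Qed.

Definition Hm_ev1 : 'Hom(Hm (regular_mod A), modr B) := @Hev (regular_mod A) 1.
Definition Hm_orb : 'Hom(modr B, Hm (regular_mod A)) := lfun_of Hm_orb_linear.

Lemma hom_Hm_orb : is_hom Hm_orb.
Proof.
move=> e x; apply/hval_inj/lfunP => a; rewrite hval_act !lfun_ofE.
by rewrite !hmkK ?orbE ?actlrC //; exact: hom_orb.
Qed.

Lemma Hm_ev1K : (Hm_orb \o Hm_ev1 = \1)%VF.
Proof.
apply/lfunP => u; apply/hval_inj; rewrite comp_lfunE !lfun_ofE id_lfunE hmkK.
  by rewrite -orb1 //; apply: hom_hval.
exact: hom_orb.
Qed.

Lemma Hm_orbK : (Hm_ev1 \o Hm_orb = \1)%VF.
Proof.
apply/lfunP => x; rewrite comp_lfunE !lfun_ofE id_lfunE hmkK ?orbE ?act1 //.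
exact: hom_orb.
Qed.

Lemma Hm_regular : inadd (eq (modr B)) (Hm (regular_mod A)).
Proof.
exact: inadd_retract (@hom_Hev (regular_mod A) 1) hom_Hm_orb Hm_ev1K
  (inadd_self erefl).
Qed.

Lemma modr_Hm_regular : inadd (eq (Hm (regular_mod A))) (modr B).
Proof.
exact: inadd_retract hom_Hm_orb (@hom_Hev (regular_mod A) 1) Hm_orbK
  (inadd_self erefl).
Qed.

Definition full := forall f : 'Hom(modl B, modl B), is_hom f ->
  exists e, forall x, f x = act (modr B) e x.

Definition faithful :=
  forall e, (forall x, act (modr B) e x = 0) -> e = 0.

Lemma ract_linear : linear (fun e => hmk (ract e) : Hm (modl B)).
Proof.
move=> c d e; rewrite -hmkP; congr hmk; apply/lfunP => x.
by rewrite add_lfunE scale_lfunE !ractE actDl actZl.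
Qed.

Definition regular_Hm : 'Hom(regular_mod E, Hm (modl B)) := lfun_of ract_linear.

Lemma hval_regular_Hm e x : hval (regular_Hm e) x = act (modr B) e x.
Proof. by rewrite lfun_ofE hmkK ?ractE //; apply: hom_ract. Qed.

Lemma hom_regular_Hm : is_hom regular_Hm.
Proof.
by move=> d e; apply/hval_inj/lfunP => x; rewrite hval_act !hval_regular_Hm actM.
Qed.

Lemma regular_Hm_inv : full -> faithful ->
  exists g : 'Hom(Hm (modl B), regular_mod E),
    [/\ is_hom g, (regular_Hm \o g = \1)%VF & (g \o regular_Hm = \1)%VF].
Proof.
move=> fu fa; apply: bij_hom_inv; first exact: hom_regular_Hm.
  by move=> e e0; apply: fa => x; rewrite -hval_regular_Hm e0 hval0 lfunE.
move=> u; have [e eE] := fu _ (hom_hval u); exists e.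
by apply/hval_inj/lfunP => x; rewrite hval_regular_Hm.
Qed.

Lemma regular_inadd_Hm : full -> faithful ->
  inadd (eq (Hm (modl B))) (regular_mod E).
Proof.
move=> fu fa; have [g [hg gK Kg]] := regular_Hm_inv fu fa.
exact: inadd_retract hom_regular_Hm hg Kg (inadd_self erefl).
Qed.

Lemma Hm_inadd_regular : full -> faithful ->
  inadd (eq (regular_mod E)) (Hm (modl B)).
Proof.
move=> fu fa; have [g [hg gK Kg]] := regular_Hm_inv fu fa.
exact: inadd_retract hg hom_regular_Hm gK (inadd_self erefl).
Qed.

(** The surjective half of reflexivity for the double dual with respect to B; the injective half is
    [cogenerated]. *)
Definition refl X := forall eta : 'Hom(Hm X, modr B), is_hom eta ->
  exists x, forall u, eta u = hval u x.

Lemma refl_add X : inadd refl X -> refl X.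
Proof.
move=> rX eta heta.
suff [x xE] : exists x, forall u, eta (Hmap (\1%VF : 'Hom(X, X)) u) = hval u x.
  by exists x => u; rewrite -xE Hmap1 id_lfunE.
elim: rX => [|Z al be f rZ hal hbe tf [y yE]].
  by exists 0 => u; rewrite Hmap0 lfunE !linear0.
have [z zE] := rZ _ (hom_comp heta (hom_Hmap hal)).
exists (be z + y) => u; rewrite HmapD; [|exact: hom_comp|exact: thru_hom tf].
rewrite add_lfunE !linearD /= yE Hmap_comp // comp_lfunE -[eta (Hmap al _)]comp_lfunE.
by rewrite zE HmapE // comp_lfunE.
Qed.

(** By fullness Hom_A(B, B) is generated over E by the identity, so an E-linear map out of it is
    evaluation at its value there. *)
Lemma refl_self : full -> refl (modl B).
Proof.
move=> fu eta heta; exists (eta (hmk \1%VF)) => u.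
have [e eE] := fu _ (hom_hval u).
rewrite eE -heta; congr (eta _); apply/hval_inj/lfunP => x.
by rewrite hval_act hmkK ?id_lfunE ?eE //; apply: hom_id.
Qed.

Lemma refl_inadd X : full -> inadd (eq (modl B)) X -> refl X.
Proof. by move=> fu aX; apply/refl_add/inadd_sub/aX => _ <-; apply: refl_self. Qed.

End HomFunctor.

(** * Double centralizers, and B as a projective-injective E-module *)

Section Balanced.
Context (k : fieldType) (A E : falgType k) (B : bimod A E).

(** Double centralizer property. Write 1 in A as a sum of elements [be (al 1)] with maps A -> B ->
    A. For fixed [x], sending y to [be y] acting on [x] is an A-endomorphism of B, hence the action
    of some [e] in E, and [f] commutes with [e]. *)
Lemma full_swap : full B -> inadd (eq (modl B)) (regular_mod A) -> full (bswap B).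
Proof.
move=> fu gA f hf.
have fE e (x : B) : f (act (modr B) e x) = act (modr B) e (f x) by apply: hf.
suff [a aE] : exists a : A, forall x : B,
    f (act (modl B) ((\1%VF : 'End(regular_mod A)) 1) x) = act (modl B) a x.
  by exists a => x; rewrite -[RHS]aE id_lfunE act1.
elim: gA => [|Z al be g QZ hal hbe _ [a aE]].
  exists 0 => x; have -> : (0 : 'End(regular_mod A)) 1 = 0 :> A by rewrite lfunE.
  by rewrite !act0l linear0.
subst Z; exists (be (f (al 1)) + a) => x.
rewrite add_lfunE comp_lfunE !actDl.
have -> y z : f (y + z) = f y + f z by apply: linearD.
rewrite aE; congr (_ + _).
have [e eE] := fu _ (hom_comp (@hom_orb _ _ (modl B) x) hbe).
have oE y : act (modl B) (be y) x = act (modr B) e y.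
  by rewrite -eE comp_lfunE orbE.
by rewrite !oE fE.
Qed.

Lemma faithful_swap : inadd (eq (modl B)) (regular_mod A) -> faithful (bswap B).
Proof.
move=> gA a a0; apply: (cogenerated_inadd gA) => f hf.
by rewrite -[a](mulr1 (a : A)) (hf a 1); apply: a0.
Qed.

Lemma functionals_separate (U : vectType k) (x : U) :
  (forall l : 'Hom(U, k^o), l x = 0) -> x = 0.
Proof.
move=> l0; rewrite (coord_vbasis (memvf x)) big1 // => i _.
have := l0 (linfun (coord (vbasis fullv) i : U -> k^o)).
by rewrite lfunE /= => ->; rewrite scale0r.
Qed.

Section Injective.
Hypotheses (fu : full B) (fa : faithful B).
Context (M N : fdmod E) (j : 'Hom(M, N)) (f : 'Hom(M, modr B)).
Hypotheses (hj : is_hom j) (mj : mono j) (hf : is_hom f).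
Context (al : 'Hom(dual_mod A, modl B)) (be : 'Hom(modl B, dual_mod A)).
Hypothesis hal : is_hom al.

Let n := \dim (fullv : {vspace modl B}).
Let b := vbasis (fullv : {vspace modl B}).
Let bs (l : 'I_n) : 'Hom(modl B, k^o) :=
  linfun (coord b l : modl B -> k^o).

Lemma dmap_ract (l : 'Hom(modl B, k^o)) e (x : B) :
  dmap l (act (modr B) e x) = dmap (l \o ract B e)%VF x.
Proof.
by apply/lfunP => a; rewrite !dmapE comp_lfunE ractE actlrC.
Qed.

Lemma functional_expand (l : 'Hom(modl B, k^o)) : l = \sum_(i < n) l b`_i *: bs i.
Proof.
apply/lfunP => x; rewrite sum_lfunE {1}(coord_vbasis (memvf x)) linear_sum.
apply: eq_bigr => i _; rewrite linearZ scale_lfunE /= lfunE /=.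
by rewrite /GRing.scale /= mulrC.
Qed.

Lemma dmap_sum I0 (r : seq I0) (c : I0 -> k) (l : I0 -> 'Hom(modl B, k^o)) x :
  dmap (\sum_(i <- r) c i *: l i) x = \sum_(i <- r) c i *: dmap (l i) x.
Proof.
apply/lfunP => a; rewrite dmapE !sum_lfunE; apply: eq_bigr => i _.
by rewrite !scale_lfunE dmapE.
Qed.

(* If the elements e l of E act as [al \o dmap l], then z |-> H (e l * z) is
   linear in the functional l on Q, hence evaluation of l at a point h z of Q. *)
Lemma inj_ext_step : exists h : 'Hom(N, modr B), is_hom h /\
  forall (l : 'Hom(modl B, k^o)) y,
    l (h (j y)) = (be (al (dmap l (f y))) : 'Hom(A, k^o)) 1.
Proof.
have/choice[e eE] : forall l : 'Hom(modl B, k^o), exists e, forall x : B,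
    al (dmap l x) = act (modr B) e x.
  move=> l; have [e eE] := fu (hom_comp hal (hom_dmap l)).
  by exists e => x; rewrite -eE comp_lfunE.
pose H : 'Hom(N, k^o) := (dual_ev1 A \o be \o f \o j^-1)%VF.
have jK := introT eqP ((lker_eq0P j).2 mj).
have HE y : H (j y) = (be (f y) : 'Hom(A, k^o)) 1.
  by rewrite !comp_lfunE lker0_lfunK // lfun_ofE.
pose hf0 (z : N) : modr B := \sum_(i < n) H (act N (e (bs i)) z) *: (b`_i : modr B).
have lin : linear hf0.
  move=> c x y; rewrite /hf0 scaler_sumr -big_split; apply: eq_bigr => i _ /=.
  by rewrite act_linear linearP scalerDl scalerA.
have lE (l : 'Hom(modl B, k^o)) z : l (lfun_of lin z) = H (act N (e l) z).
  have -> : e l = \sum_(i < n) l b`_i *: e (bs i).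
    apply/eqP; rewrite -subr_eq0; apply/eqP/fa => x.
    rewrite actBl -eE {1}[l]functional_expand dmap_sum linear_sum act_suml.
    rewrite -sumrB big1 // => i _.
    by rewrite linearZ actZl -eE subrr.
  rewrite lfun_ofE /hf0 linear_sum act_suml linear_sum; apply: eq_bigr => i _.
  by rewrite actZl !linearZ /= /GRing.scale /= mulrC.
exists (lfun_of lin); split=> [d z|l y].
  apply/eqP; rewrite -subr_eq0; apply/eqP/(@functionals_separate (modl B)) => l.
  rewrite linearB /= lE -actM.
  have -> : e l * d = e (l \o ract B d)%VF.
    apply/eqP; rewrite -subr_eq0; apply/eqP/fa => x.
    by rewrite actBl actM -!eE dmap_ract subrr.
  by rewrite -lE comp_lfunE ractE subrr.
by rewrite lE -hj HE hf -eE.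
Qed.

End Injective.

(** Classically, D(B) = Hom_A(B, D(A)) lies in add of Hom_A(B, B) = E as a right module, so B is the
    dual of a projective. Here each term [be \o al] of the identity of D(A) contributes one map from
    [inj_ext_step], and their sum extends [f]. *)
Lemma modr_injective : full B -> faithful B ->
  inadd (eq (modl B)) (dual_mod A) -> injective_mod (modr B).
Proof.
move=> fu fa gD M N j f hj /lker_eq0P mj hf.
suff [h [hh hE]] : exists h : 'Hom(N, modr B), is_hom h /\
    forall (l : 'Hom(modl B, k^o)) y, l (h (j y)) =
      (((\1%VF : 'End(dual_mod A)) (dmap l (f y))) : 'Hom(A, k^o)) 1.
  exists h; split=> //; apply/lfunP => y; rewrite comp_lfunE.
  apply/eqP; rewrite -subr_eq0; apply/eqP/(@functionals_separate (modl B)) => l.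
  by rewrite linearB /= hE id_lfunE dmapE act1 subrr.
elim: gD => [|Z al be g QZ hal hbe _ [h [hh hE]]].
  exists 0; split=> [|l y]; first exact: hom0.
  have -> : (0 : 'End(dual_mod A)) (dmap l (f y)) = 0 by rewrite lfunE.
  by rewrite !zero_lfunE linear0.
subst Z; have [h' [hh' hE']] := inj_ext_step fu fa hj mj hf be hal.
exists (h' + h); split; first exact: homD.
by move=> l y; rewrite !add_lfunE linearD /= hE hE' comp_lfunE.
Qed.

(** B is Hom_A(A, B), and A lies in add(B), so B lies in add of Hom_A(B, B) = E. *)
Lemma modr_projective : full B -> faithful B ->
  inadd (eq (modl B)) (regular_mod A) -> projective (modr B).
Proof.
move=> fu fa gA; apply: projective_add.
apply: inadd_bind (modr_Hm_regular B) => _ <-.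
apply: inadd_Hm gA => _ <-.
apply: inadd_sub (Hm_inadd_regular fu fa) => _ <-.
exact: regular_projective.
Qed.

End Balanced.

(** * The two directions of Mueller's theorem *)

Section Mueller.
Context (k : fieldType) (A E : falgType k) (B : bimod A E).
Implicit Types (X Y Z P K J : fdmod A).

Lemma Hm_projinj P : projinj (modr B) -> projective P -> projinj (Hm B P).
Proof.
move=> [iQ pQ] /proj_inadd_regular aP.
have aHP : inadd (eq (modr B)) (Hm B P).
  by apply: inadd_Hm aP => _ <-; apply: Hm_regular.
split; [apply: injective_add|apply: projective_add];
  by apply: inadd_sub aHP => _ <-.
Qed.

(** Projectives go to projective-injectives. The two units that cost no vanishing come from a
    presentation P' -> P -> X, on which the functor is left exact; each vanishing Ext^1 then keeps
    one more short exact sequence exact. *)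
Lemma van_dd t X : projinj (modr B) ->
  van (fun _ => eq (modl B)) t X -> dd t.+2 (Hm B X).
Proof.
move=> pQ; elim: t X => [|t IH] X.
  move=> _; have [P [p [pP hp ep _]]] := proj_cover X.
  have [K [i s]] := ses_ker hp ep.
  have [C [r sr]] := ses_coker (hom_Hmap (B := B) hp) (Hmap_mono (B := B) hp ep).
  have [P' [p' [pP' hp' ep' _]]] := proj_cover K.
  have [||g [hg gE]] := @factor_epi _ _ _ _ _ r (Hmap B i)
    (ses_homp sr) (ses_epi sr).
  - exact/hom_Hmap/ses_homi/s.
  - by move=> v /(ses_ex sr)[u <-]; apply: Hmap_comp0 s.
  have mg : mono g.
    move=> c; have [v <-] := ses_epi sr c; rewrite -comp_lfunE gE.
    by case/(Hmap_exact s) => u <-; apply: ses_pi sr _.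
  have hu := hom_comp (hom_Hmap (B := B) hp') hg.
  have mu : mono (Hmap B p' \o g)%VF.
    by move=> c; rewrite comp_lfunE => /(Hmap_mono hp' ep')/mg.
  have [C' [r' sr']] := ses_coker hu mu.
  exists (Hm B P), C, (Hmap B p), r; split=> //; first exact: Hm_projinj.
  exists (Hm B P'), C', (Hmap B p' \o g)%VF, r'; split=> //; exact: Hm_projinj.
case=> K [P [i [p [pP s ext vK]]]].
exists (Hm B P), (Hm B K), (Hmap B p), (Hmap B i); split.
- exact: Hm_projinj.
- by apply: ses_Hmap => //; apply: ext.
- exact: IH.
Qed.

Hypotheses (inj_Q : injective_mod (modl B)) (fuB : full B) (faB : faithful B).
Hypothesis (cogQ : cogenerated (modl B) (regular_mod A)).

Lemma projinj_inadd J : projinj J -> inadd (eq (modl B)) J.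
Proof.
move=> [iJ pJ]; apply: inj_cogen_inadd => //.
apply: cogenerated_trans cogQ _.
exact/cogenerated_inadd/proj_inadd_regular.
Qed.

Lemma Hm_projinj_projective J : projinj J -> projective (Hm B J).
Proof.
move=> /projinj_inadd aJ; apply: projective_add; apply: inadd_Hm aJ => _ <-.
apply: inadd_sub (Hm_inadd_regular fuB faB) => _ <-.
exact: regular_projective.
Qed.

Lemma injQ_extends X Y (i : 'Hom(X, Y)) : is_hom i -> mono i -> extends i (modl B).
Proof. by move=> hi mi h hh; apply: inj_extend. Qed.

(** Dominant dimension 2 gives a copresentation X -> J -> J' by modules of add(B). Pulled back to J,
    [eta] is evaluation at a point y; B cogenerates J', into which the cokernel C embeds, so [p y] =
    0 and y comes from X. *)
Lemma dd2_refl X : dd 2 X -> refl B X.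
Proof.
case=> J [C [i [p [pJ s [J' [C' [i' [p' [pJ' s' _]]]]]]]]] eta heta.
have [hi hp mi ep pi ex] := s.
have [y yE] := refl_inadd fuB (projinj_inadd pJ) (hom_comp heta (hom_Hmap (B := B) hi)).
have py0 : p y = 0.
  apply: (cogenerated_mono (ses_homi s') (ses_mono s')
    (cogenerated_inadd (projinj_inadd pJ'))) => g hg.
  have := yE (@Hmap _ _ _ B _ _ p (hmk g)).
  rewrite comp_lfunE (Hmap_comp0 _ s) linear0 HmapE // hmkK // comp_lfunE.
  by move=> <-.
have [x xE] := ex _ py0; exists x => u.
have [v <-] := Hmap_epi hi (injQ_extends hi mi) u.
by have := yE v; rewrite comp_lfunE => ->; rewrite HmapE // comp_lfunE xE.
Qed.

(** An E-map from Hom_A(C, B) to B is evaluation at some c, since C still has dominant dimension 2;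
    evaluation at a preimage of c in J extends it. Reflexivity of the cosyzygies accounts for the
    shift by two. *)
Lemma dd_van t X : dd t.+2 X -> van (fun _ => eq (modr B)) t (Hm B X).
Proof.
elim: t X => // t IH X [J [C [i [p [pJ s dC]]]]].
have sH := ses_Hmap s (injQ_extends (ses_homi s) (ses_mono s)).
exists (Hm B C), (Hm B J), (Hmap B p), (Hmap B i); split=> //; last exact: IH.
  exact: Hm_projinj_projective.
move=> _ <- h hh.
have [c cE] := dd2_refl (dd_leq (isT : (2 <= t.+2)%N) dC) hh.
have [y yc] := ses_epi s c; exists (Hev B y); split; first exact: hom_Hev.
apply/lfunP => u; rewrite comp_lfunE HevE cE HmapE; last exact: ses_homp s.
by rewrite comp_lfunE yc.
Qed.

End Mueller.

Section GenCogen.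
Context (k : fieldType) (A E : falgType k) (B : bimod A E).
Hypotheses (fuB : full B) (faB : faithful B).
Hypothesis gA : inadd (eq (modl B)) (regular_mod A).
Hypothesis gD : inadd (eq (modl B)) (dual_mod A).
Implicit Types (X Y Z P K J : fdmod A).

Lemma modr_projinj : projinj (modr B).
Proof. by split; [apply: modr_injective|apply: modr_projective]. Qed.

(** From left to right, [dd_van] is applied with A and E exchanged: A is the full endomorphism ring
    of B over E, and Hom_E(E, B) is B as an A-module. From right to left, [van_dd] is applied to B
    itself, whose image Hom_A(B, B) is E. *)
Lemma mueller t :
  dd t.+2 (regular_mod E) <-> van (fun _ => eq (modl B)) t (modl B).
Proof.
split=> [dE|vM].
  have cogE : cogenerated (modr B) (regular_mod E).
    move=> e e0; apply: faB => x.
    by rewrite -(e0 (orb x)) ?orbE //; apply: hom_orb.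
  have := dd_van (B := bswap B) modr_projinj.1 (full_swap fuB gA)
    (faithful_swap gA) cogE dE.
  move=> v; apply: van_add; apply: inadd_sub (modr_Hm_regular (bswap B)) => _ <-.
  exact: v.
apply: dd_add; apply: inadd_sub (regular_inadd_Hm fuB faB) => _ <-.
exact: van_dd modr_projinj vM.
Qed.

(** * Transport of semisimplicity from E back to A *)

Section AllProjective.
Hypothesis allP : forall Y : fdmod E, projective Y.

(** Both halves of the image factorization split, and composing the splittings gives the
    quasi-inverse. *)
Lemma regular_hom (Y Z : fdmod E) (f : 'Hom(Y, Z)) : is_hom f ->
  exists g : 'Hom(Z, Y), is_hom g /\ (f \o g \o f)%VF = f.
Proof.
move=> hf; have [T [p [i [hp hi ep mi fE]]]] := image_factor hf.
have [u [hu pu]] := proj_split (@allP T) hp ep.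
have [C [q s]] := ses_coker hi mi.
have [r [hr ri]] := proj_ses_split s (@allP C).
exists (u \o r)%VF; split; first exact: hom_comp.
rewrite -{}fE !comp_lfunA -(comp_lfunA i p u) pu comp_lfun1r.
by rewrite -(comp_lfunA i r i) ri comp_lfun1r.
Qed.

(** By reflexivity, [Psi] followed by evaluation at [y] is evaluation at a point of X; cogeneration
    makes this point unique, hence A-linear in [y]. *)
Lemma Hm_fullness X Y (Psi : 'Hom(Hm B X, Hm B Y)) :
  refl B X -> cogenerated (modl B) X -> is_hom Psi ->
  exists g : 'Hom(Y, X), is_hom g /\ forall u y, hval (Psi u) y = hval u (g y).
Proof.
move=> rX cX hPsi.
have /choice[g gE] : forall y, exists x, forall u, hval (Psi u) y = hval u x.
  move=> y; have [x xE] := rX _ (hom_comp (hom_Hev (B := B) y) hPsi).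
  by exists x => u; rewrite -xE comp_lfunE HevE.
have uniq x x' : (forall u : Hm B X, hval u x = hval u x') -> x = x'.
  move=> ux; apply/eqP; rewrite -subr_eq0; apply/eqP/cX => f hf.
  by rewrite -(hmkK hf) linearB /= ux subrr.
have lin : linear g.
  by move=> c y y'; apply: uniq => u; rewrite -gE !linearP /= !gE.
exists (lfun_of lin); split=> [a y|u y]; last by rewrite lfun_ofE.
apply: uniq => u; rewrite !lfun_ofE -gE (hom_hval u) -gE.
exact: (hom_hval (Psi u)).
Qed.

(* Von Neumann regularity of E, transported by the full functor Hom(-, Q). *)
Lemma regular_hom_addQ X Y (f : 'Hom(X, Y)) :
  inadd (eq (modl B)) X -> cogenerated (modl B) Y -> is_hom f ->
  exists g : 'Hom(Y, X), is_hom g /\ (f \o g \o f)%VF = f.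
Proof.
move=> aX cY hf; have [Psi [hPsi PsiE]] := regular_hom (hom_Hmap (B := B) hf).
have [g [hg gE]] := Hm_fullness (refl_inadd fuB aX) (cogenerated_inadd aX) hPsi.
exists g; split=> //; apply/lfunP => x; apply/eqP; rewrite -subr_eq0; apply/eqP.
apply: cY => h hh; rewrite linearB /= !comp_lfunE.
have hE y : h (f y) = hval (Hmap B f (hmk h : Hm B Y)) y.
  by rewrite HmapE // hmkK // comp_lfunE.
rewrite !hE -gE -{2}PsiE !comp_lfunE [in X in _ - X]HmapE // comp_lfunE.
by rewrite subrr.
Qed.

(** The composite P -> X -> Z -> J runs between modules of add(B), so it has a quasi-inverse [g];
    cancelling the surjection [p] and the injection [i \o j] makes [p \o g \o i] a retraction. *)
Lemma all_mono_split X Z (j : 'Hom(X, Z)) : is_hom j -> mono j ->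
  exists r : 'Hom(Z, X), is_hom r /\ (r \o j = \1)%VF.
Proof.
move=> hj mj; have [P [p [_ hp ep aP]]] := proj_cover X.
have [J [i [_ hi mi aJ]]] := inj_hull Z.
have aP' : inadd (eq (modl B)) P by apply: inadd_bind aP => _ <-.
have cJ : cogenerated (modl B) J.
  by apply/cogenerated_inadd; apply: inadd_bind aJ => _ <-.
have hij := hom_comp hi hj; have hijp := hom_comp hij hp.
have mij : mono (i \o j)%VF by move=> x; rewrite comp_lfunE => /mi/mj.
have [g [hg gE]] := regular_hom_addQ aP' cJ hijp.
exists (p \o g \o i)%VF; split; first by auto with homdb.
apply/lfunP => x; have [z <-] := ep x; apply: (mono_eq mij).
move/lfunP/(_ z): gE; rewrite !comp_lfunE id_lfunE => ->.
by [].
Qed.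

End AllProjective.
End GenCogen.

Section EndBimod.
Context (k : fieldType) (A : falgType k) (M : fdmod A) (nzM : ~ mod_zero M).

Definition endo_act (e : End_alg nzM) (x : M) : M := vsval (e : endo nzM) x.

Definition endo_bimod : bimod A (End_alg nzM).
Proof.
refine (@Bimod k A (End_alg nzM) M (act M) endo_act _ _ _ _ _ _ _ _ _).
- exact: act_linear.
- exact: act_linearl.
- exact: act1.
- exact: actM.
- by move=> e c x y; rewrite /endo_act linearP.
- by move=> x c d e; rewrite /endo_act /= add_lfunE scale_lfunE.
- by move=> x; rewrite /endo_act /= id_lfunE.
- by move=> d e x; rewrite /endo_act -endo_mulE.
- by move=> a e x; rewrite /endo_act; have /homvP -> := subvsP e.
Defined.

Lemma full_endo : full endo_bimod.
Proof.
move=> f hf; have fM : (f : 'Hom(M, M)) \in homv M M by apply/homvP.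
by exists (Subvs fM).
Qed.

Lemma faithful_endo : faithful endo_bimod.
Proof.
move=> e e0; apply/val_inj/lfunP => x; rewrite [RHS]lfunE; exact: e0.
Qed.

End EndBimod.

Lemma modl_endo (k : fieldType) (A : falgType k) (M : fdmod A)
  (nzM : ~ mod_zero M) : modl (endo_bimod nzM) = M.
Proof. by case: M nzM. Qed.

(** * Global dimension and semisimplicity *)

Section GlobalDimension.
Context (k : fieldType) (E : falgType k).
Implicit Types (X Y Z P K J C : fdmod E).

(* Projective dimension at most n, as the vanishing of Ext^(n+1)(X, -). *)
Definition pdle n X := van (fun s (_ : fdmod E) => s = 0%N) n.+1 X.

(** Term d+1 maps onto the kernel of [q], so this kernel is zero and any map out of it extends. *)
Lemma pdle_resolution d X (R : proj_resolution X) :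
  (forall i, (d < i)%N -> mod_zero (pr_mod R i)) -> pdle d X.
Proof.
move=> R0.
have [||Z [q [hq eq ex SZ]]] := @resolution_syzygy k E X R
  (fun i Z => (i <= d)%N -> pdle (d - i) Z -> pdle d X) _ _ d.
- by rewrite subn0.
- move=> i K P Z j p pP s SZ lt_id pK; apply: SZ; first exact: ltnW.
  rewrite -(subnSK lt_id); exists K, P, j, p; split=> //.
apply: SZ => //; rewrite subnn; have [K [i s]] := ses_ker hq eq.
exists K, (pr_mod R d), i, q; split=> //; first exact: pr_proj.
move=> N _ h hh; exists 0; split; first exact: hom0.
apply/lfunP => x; suff -> : x = 0 by rewrite !linear0.
apply: (ses_mono s); have /ex[y <-] := ses_pi s x.
by rewrite (R0 d.+1 (leqnn _) y) linear0.
Qed.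

Lemma pdle0_projective X : pdle 0 X -> projective X.
Proof.
case=> K [P [i [p [pP s ext _]]]].
have [r [hr ri]] := ext K erefl _ (@hom_id _ _ K).
have hD : is_hom (\1 - (i \o r))%VF.
  by apply: homB; [exact: hom_id|apply: hom_comp hr; exact: ses_homi s].
have [|u [hu up]] := factor_epi (ses_homp s) (ses_epi s) hD.
  move=> y /(ses_ex s)[x <-]; rewrite add_lfunE opp_lfunE id_lfunE comp_lfunE.
  by rewrite -[r (i x)]comp_lfunE ri id_lfunE subrr.
apply: projective_add; apply: (inadd_retract hu (ses_homp s)); last exact: inadd_self pP.
apply/lfunP => z; have [y <-] := ses_epi s z; rewrite comp_lfunE id_lfunE.
rewrite -[u (p y)]comp_lfunE up add_lfunE opp_lfunE id_lfunE linearB /= comp_lfunE.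
by rewrite (ses_pi s) subr0.
Qed.

Lemma gldim_pdle : efinite (gldim E) -> exists d, forall X, pdle d X.
Proof.
case/esup_finiteP => d dP; exists d => X.
have := dP (projdim X) (ex_intro _ X erefl); case pX: (projdim X) => [m|] // le_md.
have [[R R0] _] := (eleastP _ _).1 pX.
by apply: (@pdle_resolution d X R) => i lt_di; apply: R0; apply: leq_ltn_trans lt_di.
Qed.

(** Z is a syzygy of its cosyzygy C because J is projective, so its bound is one less than that of
    C; the last cosyzygy starts with the global bound m + n. *)
Lemma dd_pdle m n Z : (forall Y, pdle (m + n) Y) -> dd n Z -> pdle m Z.
Proof.
elim: n m Z => [|n IH] m Z; first by rewrite addn0.
move=> pd [J [C [i [p [[_ pJ] s dC]]]]].
have /(van_ses pJ s)[] // : pdle m.+1 C.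
by apply: IH dC => Y; rewrite addSnnS.
Qed.

(* The d-th cosyzygy has projective dimension at most d, so the first one is
   projective, E is self-injective and finite projective resolutions split. *)
Lemma dd_gldim_projective d : (forall Y, pdle d Y) -> dd d.+1 (regular_mod E) ->
  forall Y, projective Y.
Proof.
move=> pd [J [C [i [p [[iJ _] s dC]]]]].
have pC : projective C by apply/pdle0_projective/dd_pdle/dC.
have [r [hr ri]] := proj_ses_split s pC.
have iE : injective_mod (regular_mod E).
  apply: injective_add; apply: (inadd_retract (ses_homi s) hr ri).
  exact: inadd_self.
have iP P : projective P -> injective_mod P.
  move=> /proj_inadd_regular aP; apply: injective_add.
  by apply: inadd_sub aP => _ <-.
suff H n Y : pdle n Y -> projective Y by move=> Y; apply: H (pd Y).
elim: n Y => [|n IH] Y; first exact: pdle0_projective.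
case=> K [P [j [q [pP s' _ /IH/iP iK]]]].
have [u [hu qu]] := inj_ses_split s' iK.
apply: projective_add; apply: (inadd_retract hu (ses_homp s') qu).
exact: inadd_self.
Qed.

End GlobalDimension.

Section Semisimple.
Context (k : fieldType) (A : falgType k).
Hypothesis splitA : forall (X Z : fdmod A) (j : 'Hom(X, Z)), is_hom j -> mono j ->
  exists r : 'Hom(Z, X), is_hom r /\ (r \o j = \1)%VF.

Lemma simple_submod_exists (M : fdmod A) (U : {vspace M}) :
  is_submod U -> U <> 0%VS ->
  exists S : {vspace M}, simple_submod S /\ (S <= U)%VS.
Proof.
move=> hU U0.
(* Maximizing the codimension in U selects a nonzero submodule of least dimension. *)
have [||S [[hS S0 SU] minS]] := @ex_max {vspace M}
  (fun S => [/\ is_submod S, S <> 0%VS & (S <= U)%VS])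
  (fun S => \dim U - \dim S)%N (\dim U).
- by exists U; split=> //; apply: subvv.
- by move=> S _; apply: leq_subr.
exists S; split=> //; split=> // W hW WS; case: (eqVneq W 0%VS) => [|W0]; first by left.
right; apply/eqP; rewrite eqEdim WS /=.
have := minS W; rewrite /= leq_sub2lE; last exact: dimvS.
apply; split=> //; first exact/eqP.
exact: subv_trans WS SU.
Qed.

Lemma submod_complement (M : fdmod A) (S U : {vspace M}) :
  is_submod S -> is_submod U -> (S <= U)%VS ->
  exists W : {vspace M}, [/\ is_submod W, (S :&: W = 0)%VS & (S + W = U)%VS].
Proof.
move=> hS hU SU.
have [r [hr ri]] := splitA (hom_sub_incl (hU := hS)) (mono_sub_incl (hU := hS)).
have rE x : x \in S -> vsval (r x) = x.
  move=> /(sub_incl_imgP hS)[y <-].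
  by rewrite -[r _]comp_lfunE ri id_lfunE sub_inclE.
exists (lker r :&: U)%VS; split.
- by apply: submod_cap => //; apply: submod_lker.
- apply/eqP; rewrite -subv0; apply/subvP => x.
  rewrite !memv_cap memv_ker => /and3P[/rE xE /eqP rx0 _].
  by rewrite -xE rx0 linear0 mem0v.
- apply/eqP; rewrite eqEsubv subv_add SU capvSr /=; apply/subvP => x xU.
  have rS : vsval (r x) \in S by apply: subvsP.
  rewrite -[x](subrKC (vsval (r x))); apply: memv_add => //.
  rewrite memv_cap memv_ker linearB /= memvB ?(subvP SU _ rS) // andbT.
  have -> : r (vsval (r x)) = r x by apply/val_inj; rewrite /= rE.
  by rewrite subrr.
Qed.

Lemma semisimple_submod (M : fdmod A) n (U : {vspace M}) :
  is_submod U -> (\dim U <= n)%N ->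
  exists m (V : 'I_m -> {vspace M}), [/\ forall i, simple_submod (V i),
    directv (\sum_(i < m) V i) & (\sum_(i < m) V i)%VS = U].
Proof.
elim: n U => [|n IH] U hU dimU.
  exists 0%N, (fun _ => 0%VS); split; first by case.
    by rewrite directvE /= !big_ord0 dimv0.
  by rewrite big_ord0; apply/esym/eqP; rewrite -dimv_eq0 -leqn0.
case: (eqVneq U 0%VS) => [->|/eqP U0].
  by apply: IH; [exact: submod0|rewrite dimv0].
have [S [sS SU]] := simple_submod_exists hU U0.
have [hS S0 _] := sS.
have [W [hW SW UE]] := submod_complement hS hU SU.
have dimE : \dim U = (\dim S + \dim W)%N by rewrite -UE dimv_disjoint_sum.
have [|m [V [sV dV VE]]] := IH W hW.
  have : (0 < \dim S)%N by rewrite lt0n dimv_eq0; apply/eqP.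
  move: dimU; rewrite dimE; case: (\dim S) => // d.
  by rewrite addSn ltnS => /(leq_trans (leq_addl _ _)).
exists m.+1, (fun i => if unlift ord0 i is Some j then V j else S).
have VS : (\sum_(i < m.+1) (if unlift ord0 i is Some j then V j else S) = U)%VS.
  rewrite big_ord_recl unlift_none; under eq_bigr do rewrite liftK.
  by rewrite VE.
split=> //.
  by move=> i; case: unliftP => [j _|_].
rewrite directvE /= VS dimE big_ord_recl unlift_none.
under eq_bigr do rewrite liftK.
by move: dV; rewrite directvE /= VE => /eqP <-.
Qed.

Lemma semisimple_of_split : semisimple_alg A.
Proof.
exact: semisimple_submod (@submodf _ _ _) (leqnn _).
Qed.

End Semisimple.

(** * Modules with local endomorphism ring *)

Section Local.
Context (k : fieldType) (A : falgType k).
Implicit Types (M N X Y Z : fdmod A).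

(** Fitting's form of a local endomorphism ring; injective means bijective in finite dimension. The
    zero module qualifies, which is harmless because factors are only counted from above. *)
Definition local M := forall f : 'Hom(M, M), is_hom f ->
  (exists m, forall x, iter m f x = 0) \/ mono f.

Definition retract X M := exists (i : 'Hom(X, M)) (p : 'Hom(M, X)),
  [/\ is_hom i, is_hom p & (p \o i = \1)%VF].

Lemma retract_trans Y X M : retract X Y -> retract Y M -> retract X M.
Proof.
move=> [i [p [hi hp E]]] [j [q [hj hq F]]].
exists (j \o i)%VF, (p \o q)%VF; split; try exact: hom_comp.
by rewrite comp_lfunA -(comp_lfunA p q j) F comp_lfun1r.
Qed.

Lemma iter_lfunE M (f : 'Hom(M, M)) m x :
  iter m (comp_lfun f) \1%VF x = iter m f x.
Proof. by elim: m => [|m IH] /=; rewrite ?id_lfunE // comp_lfunE IH. Qed.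

Lemma hom_iter M (f : 'Hom(M, M)) m : is_hom f -> is_hom (iter m (comp_lfun f) \1%VF).
Proof. by move=> hf; elim: m => [|m IH] /=; auto with homdb. Qed.

(** For a power [F m] of [f] whose kernel has stopped growing, M is the sum of the image X and the
    kernel Y of [F m]. X is proper because [f] is not injective, Y because no power of [f] is
    zero. *)
Lemma fitting M : ~ local M -> exists X Y (i : 'Hom(X, M)) (p : 'Hom(M, X))
    (j : 'Hom(Y, M)) (q : 'Hom(M, Y)),
  [/\ [/\ is_hom i, is_hom p, is_hom j & is_hom q],
      (p \o i = \1)%VF, (q \o j = \1)%VF,
      (\1 = (i \o p) + (j \o q))%VF
    & (mdim X < mdim M)%N /\ (mdim Y < mdim M)%N].
Proof.
move=> /existsNP[f /not_implyP[hf /not_orP[nnil nmono]]].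
pose F m : 'Hom(M, M) := iter m (comp_lfun f) \1%VF.
have FE m x : F m x = iter m f x by apply: iter_lfunE.
have [||m [_ maxm]] := @ex_max nat (fun _ => True) (fun m => \dim (lker (F m))) (mdim M).
- by exists 0%N.
- by move=> m _; rewrite dimvS ?subvf.
have kerF n : (m <= n)%N -> lker (F n) = lker (F m).
  move=> le_mn; apply/esym/eqP; rewrite eqEdim maxm // andbT.
  apply/subvP => x; rewrite !memv_ker !FE -(subnK le_mn) iterD => /eqP ->.
  by rewrite -FE linear0.
have hg : is_hom (F m) by apply: hom_iter.
have [X [p [i [hp hi ep mi gE]]]] := image_factor hg.
(* [F m] is injective on its own image, since [F (m + m)] and [F m] have the same kernel. *)
have mpi : mono (p \o i)%VF.
  move=> z; have [x <-] := ep z; rewrite comp_lfunE -[i (p x)]comp_lfunE gE.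
  move=> pg0; have : x \in lker (F (m + m)%N).
    by rewrite memv_ker FE iterD -!FE -gE comp_lfunE gE pg0 linear0.
  rewrite kerF ?leq_addr // memv_ker -gE comp_lfunE => /eqP/mi.
  by [].
have hpi := hom_comp hp hi.
have [w [hw piw wpi]] := bij_hom_inv hpi mpi (mono_epi mpi (leqnn _)).
have hwp := hom_comp hw hp.
have wpK : ((w \o p) \o i = \1)%VF by rewrite -comp_lfunA.
have ewp : epi (w \o p)%VF by move=> x; exists (i x); rewrite -comp_lfunE wpK id_lfunE.
have [Y [j s]] := ses_ker hwp ewp; have [hj _ mj _ pj ex] := s.
have hD : is_hom (\1 - (i \o (w \o p)))%VF.
  by apply: homB; [exact: hom_id|exact: hom_comp].
have [|q [hq jq]] := lift_mono hj mj hD.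
  move=> x; apply: ex; rewrite add_lfunE opp_lfunE id_lfunE linearB /=.
  by rewrite [X in _ - _ X]comp_lfunE -[_ (i _)]comp_lfunE wpK id_lfunE subrr.
exists X, Y, i, (w \o p)%VF, j, q; split=> //.
- apply/lfunP => y; apply: (mono_eq mj).
  rewrite comp_lfunE -[j (q _)]comp_lfunE jq add_lfunE opp_lfunE !id_lfunE comp_lfunE.
  by rewrite pj linear0 subr0.
- by rewrite jq addrC subrK.
split.
  rewrite ltnNge; apply/negP => le; apply: nmono => x fx0.
  have mp : mono p by apply: epi_mono.
  have : x \in lker (F m.+1) by rewrite memv_ker FE iterSr fx0 -FE linear0.
  by rewrite kerF // memv_ker -gE comp_lfunE => /eqP/mi/mp.
rewrite ltnNge; apply/negP => le; apply: nnil; exists m => x.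
have [y <-] := mono_epi mj le x.
rewrite -FE -gE comp_lfunE; have /(congr1 (p \o i)%VF) := pj y.
by rewrite linear0 -[LHS]comp_lfunE comp_lfunA piw comp_lfun1l => ->; rewrite linear0.
Qed.

Lemma local_decomposition M : inadd (fun Z => local Z /\ retract Z M) M.
Proof.
have [n le_n] := ubnP (mdim M); elim: n M le_n => // n IH M le_n.
case: (pselect (local M)) => [lM|/fitting].
  apply: inadd_self; split=> //; exists \1%VF, \1%VF; split; try exact: hom_id.
  exact: comp_lfun1l.
move=> [X [Y [i [p [j [q [[hi hp hj hq] pi qj E [ltX ltY]]]]]]]].
have sub Z : retract Z M -> forall (a : 'Hom(Z, M)) (b : 'Hom(M, Z)),
    is_hom a -> is_hom b -> (mdim Z < mdim M)%N ->
    thru (fun Z => local Z /\ retract Z M) (a \o b)%VF.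
  move=> rZ a b ha hb ltZ.
  have tZ := thru_comp2 hb ha (IH Z (leq_trans ltZ le_n)).
  rewrite comp_lfun1r in tZ.
  have := thru_bind (D := fun Z => local Z /\ retract Z M) _
    (@hom_id _ _ _) (@hom_id _ _ _) tZ.
  rewrite comp_lfun1l comp_lfun1r; apply=> V [lV rV]; apply: inadd_self.
  by split=> //; apply: retract_trans rZ.
rewrite /inadd E; apply: thruD; apply: sub => //.
  by exists i, p.
by exists j, q.
Qed.

(** [thru] with the number of terms recorded; for an identity map and local factors this number will
    bound the simples of the endomorphism ring. *)
Inductive thrun (C : fdmod A -> Prop) X Y : nat -> 'Hom(X, Y) -> Prop :=
| thrun0 : thrun C 0 0
| thrunS Z (al : 'Hom(X, Z)) (be : 'Hom(Z, Y)) n f :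
    C Z -> is_hom al -> is_hom be -> thrun C n f ->
    thrun C n.+1 ((be \o al)%VF + f).

Lemma thru_thrun C X Y (f : 'Hom(X, Y)) : thru C f -> exists n, thrun C n f.
Proof.
elim=> [|Z al be g CZ hal hbe _ [n tg]]; first by exists 0%N; apply: thrun0.
by exists n.+1; apply: thrunS.
Qed.

Lemma thrunD C X Y m n (f g : 'Hom(X, Y)) :
  thrun C m f -> thrun C n g -> thrun C (m + n) (f + g).
Proof.
elim=> [|Z al be p f' CZ hal hbe _ IH] tg; first by rewrite add0r.
by rewrite -addrA addSn; apply: thrunS => //; apply: IH.
Qed.

Lemma thrun_comp2 C W X Y V n (f : 'Hom(X, Y)) (g : 'Hom(W : fdmod A, X))
    (h : 'Hom(Y, V : fdmod A)) :
  is_hom g -> is_hom h -> thrun C n f -> thrun C n (h \o f \o g)%VF.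
Proof.
move=> hg hh; elim=> [|Z al be m f' CZ hal hbe _ IH].
  by rewrite comp_lfun0r comp_lfun0l; apply: thrun0.
rewrite comp_lfunDr comp_lfunDl comp_lfunA -comp_lfunA.
by apply: thrunS => //; apply: hom_comp.
Qed.

Lemma thrun_dsum C X Y m n : thrun C m (\1%VF : 'End(X)) ->
  thrun C n (\1%VF : 'End(Y)) -> thrun C (m + n) (\1%VF : 'End(dsum_mod X Y)).
Proof.
move=> tX tY; rewrite ds_id; apply: thrunD.
  have := thrun_comp2 (@hom_pr1 _ _ X Y) (@hom_in1 _ _ X Y) tX.
  by rewrite comp_lfun1r.
have := thrun_comp2 (@hom_pr2 _ _ X Y) (@hom_in2 _ _ X Y) tY.
by rewrite comp_lfun1r.
Qed.

End Local.

(** * Counting simple modules *)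

Section Simples.
Context (k : fieldType) (E : falgType k).
Implicit Types (S T : fdmod E).

Lemma mod_iso_sym S T : mod_iso S T -> mod_iso T S.
Proof.
case=> f [hf bf].
have mf : mono f by move=> x; rewrite -(linear0 f) => /(bij_inj bf).
have ef : epi f by case: bf => g _ gf y; exists (g y).
have [g [hg fg gf]] := bij_hom_inv hf mf ef.
apply: (mod_isoP hg) => [y gy0|x].
  by rewrite -[y]id_lfunE -fg comp_lfunE gy0 linear0.
by exists (f x); rewrite -comp_lfunE gf id_lfunE.
Qed.

Lemma simple_gen T (x : T) : simple_mod T -> x <> 0 -> epi (orb x).
Proof.
case=> _ _ sT x0; apply/limg_fullP.
case: (sT (limg (orb x)) (submod_limg (hom_orb x)) (subvf _)) => // E0.
case: x0; have : orb x 1 \in limg (orb x) by rewrite memv_img ?memvf.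
by rewrite E0 orbE act1 memv0 => /eqP.
Qed.

Lemma simple_mono T (M : fdmod E) (f : 'Hom(T, M)) x :
  simple_mod T -> is_hom f -> f x <> 0 -> mono f.
Proof.
case=> _ _ sT hf fx0; apply/lker_eq0P.
case: (sT (lker f) (submod_lker hf) (subvf _)) => // E0.
by case: fx0; apply/eqP; rewrite -memv_ker E0 memvf.
Qed.

(** If the annihilator of [x'] kills [x], then sending [x'] to [x] defines a map from T' to T.
    Otherwise that annihilator moves [x] over all of T, so it contains some u with u x = x, which
    the hypothesis forbids. *)
Lemma simple_iso T T' (x : T) (x' : T') :
  simple_mod T -> simple_mod T' -> x <> 0 -> x' <> 0 ->
  (forall u : E, act T u x = x -> act T' u x' <> 0) -> mod_iso T' T.
Proof.
move=> sT sT' x0 x'0 ux; have ox := simple_gen sT x0; have ox' := simple_gen sT' x'0.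
pose W := (orb x @: lker (orb x'))%VS.
have hW : is_submod W.
  move=> a _ /memv_imgP[u uK ->]; rewrite -hom_orb memv_img //.
  exact: submod_lker (hom_orb x') _ _ uK.
have [_ _ irrT] := sT; case: (irrT W hW (subvf _)) => WE.
  have [|g [hg gE]] := factor_epi (hom_orb x') ox' (hom_orb x).
    move=> u /eqP; rewrite -memv_ker => uK; apply/eqP; rewrite -memv0 -WE.
    exact: memv_img.
  have gx : g x' = x.
    by rewrite -[x']act1 -[x in RHS]act1 -!orbE -gE comp_lfunE.
  have mg : mono g by apply: (simple_mono (x := x')) => //; rewrite gx.
  apply: (mod_isoP hg mg) => y; have [u <-] := ox y.
  by exists (orb x' u); rewrite -comp_lfunE gE.
have /memv_imgP[u uK /esym] : x \in W by rewrite WE memvf.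
by rewrite orbE => /ux; case; apply/eqP; rewrite -orbE -memv_ker.
Qed.

Lemma num_simples_seq m (S : nat -> fdmod E) :
  (forall i, (i < m)%N -> simple_mod (S i)) ->
  (forall i j, (i < m)%N -> (j < m)%N -> mod_iso (S i) (S j) -> i = j) ->
  (forall T, simple_mod T -> exists2 i, (i < m)%N & mod_iso T (S i)) ->
  num_simples E m.
Proof.
move=> sS nS aS; exists (fun i => S i); split=> [i|i j iS|T /aS[i lt_im TS]].
- exact/sS/ltn_ord.
- by apply/val_inj/nS; rewrite ?ltn_ord.
- by exists (Ordinal lt_im).
Qed.

Context (A : falgType k) (B : bimod A E).
Hypotheses (fuB : full B) (faB : faithful B).

(** At most one simple survives [e]. Otherwise some [u] satisfies u e t = t and u e t' = 0. If [al],
    [u], [be] compose to a nilpotent map of Z, then u e is nilpotent, against u e t = t; if to an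
    invertible one, then e lies in E u e, against e t' <> 0. *)
Lemma simple_top (Z : fdmod A) (al : 'Hom(modl B, Z)) (be : 'Hom(Z, modl B))
    (e : E) T T' (t : T) (t' : T') :
  local Z -> is_hom al -> is_hom be ->
  (forall x, act (modr B) e x = be (al x)) ->
  simple_mod T -> simple_mod T' -> act T e t <> 0 -> act T' e t' <> 0 ->
  mod_iso T' T.
Proof.
move=> lZ hal hbe eE sT sT' et0 et'0; apply: (simple_iso sT sT' et0 et'0) => u' u'x u'x'.
have [s] := simple_gen sT et0 t; rewrite orbE => sx.
pose u := s * u'.
have ut : act T (u * e) t = t by rewrite !actM u'x.
have ut' : act T' (u * e) t' = 0 by rewrite !actM u'x' act0r.
have hu : is_hom (al \o ract B u \o be)%VF.
  by apply: hom_comp => //; apply: hom_comp => //; apply: hom_ract.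
case: (lZ _ hu) => [[m nil]|mv].
  suff ue0 : (u * e) ^+ m.+1 = 0.
    have : act T ((u * e) ^+ m.+1) t = t.
      by elim: (m.+1) => [|n IH]; rewrite ?expr0 ?act1 // exprS actM IH.
    by rewrite ue0 act0l => t0; apply: et0; rewrite -t0 act0r.
  apply: faB => x.
  have powE n : act (modr B) ((u * e) ^+ n.+1) x =
      act (modr B) u (be (iter n (al \o ract B u \o be)%VF (al x))).
    elim: n => [|n IH]; first by rewrite expr1 actM eE.
    by rewrite exprS actM IH actM eE /= !comp_lfunE ractE.
  by rewrite powE nil linear0 -[X in act _ _ X](act0r (modr B) 0) -actM mulr0 act0l.
have [w [hw _ wv]] := bij_hom_inv hu mv (mono_epi mv (leqnn _)).
have hbw : is_hom (be \o w \o al)%VF by auto with homdb.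
have [d dE] := fuB hbw.
case: et'0; suff -> : e = d * (u * e) by rewrite actM ut' act0r.
apply/eqP; rewrite -subr_eq0; apply/eqP/faB => x.
rewrite actBl actM (actM u) -dE !comp_lfunE !eE.
apply/eqP; rewrite subr_eq0; apply/eqP; congr (be _).
by have /lfunP/(_ (al x)) := wv; rewrite !comp_lfunE id_lfunE ractE => /esym.
Qed.

(** By [simple_top] each term of the sum adds at most one simple to the list. The statement covers
    every [e] that acts as a sum of n terms, so that the induction can pass to [e - e1]. *)
Lemma simples_thrun n (f : 'Hom(modl B, modl B)) (e : E) :
  thrun (@local k A) n f -> (forall x, act (modr B) e x = f x) ->
  exists m (S : nat -> fdmod E), [/\ (m <= n)%N,
    forall i, (i < m)%N -> simple_mod (S i),
    forall i j, (i < m)%N -> (j < m)%N -> mod_iso (S i) (S j) -> i = j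
    & forall T (t : T), simple_mod T -> act T e t <> 0 ->
        exists2 i, (i < m)%N & mod_iso T (S i)].
Proof.
move=> tf; elim: tf e => {n f} [|Z al be n f lZ hal hbe tf IH] e eE.
  exists 0%N, (fun _ => regular_mod E); split=> // T t _.
  by have -> : e = 0; [apply: faB => x; rewrite eE lfunE|rewrite act0l].
have hba := hom_comp hbe hal; have [e1 e1E] := fuB hba.
have e1E' x : act (modr B) e1 x = be (al x) by rewrite -e1E comp_lfunE.
have [|m [S [le_mn sS nS aS]]] := IH (e - e1).
  by move=> x; rewrite actBl eE e1E' add_lfunE comp_lfunE addrAC subrr add0r.
case: (pselect (exists T (t : T), [/\ simple_mod T, act T e1 t <> 0
    & forall i, (i < m)%N -> ~ mod_iso T (S i)])) => [[T0 [t0 [sT0 et0 nT0]]]|noT].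
  exists m.+1, (fun i => if i == m then T0 else S i); split=> //.
  - move=> i; rewrite ltnS leq_eqVlt; case: eqP => //= _; exact: sS.
  - move=> i j; rewrite ltnS leq_eqVlt => lt_im.
    rewrite ltnS leq_eqVlt => lt_jm; move: lt_im lt_jm.
    case: eqP => [->|_]; case: eqP => [->|_] //=.
    + by move=> _ lt_jm /(nT0 j lt_jm).
    + by move=> lt_im _ /mod_iso_sym /(nT0 i lt_im).
    + exact: nS.
  move=> T t sT et; case: (pselect (act T e1 t = 0)) => [e1t|e1t].
    have [|i lt_im TS] := aS T t sT; first by rewrite actBl e1t subr0.
    by exists i; [exact: ltnW|rewrite ltn_eqF].
  exists m; rewrite ?eqxx //.
  exact: (simple_top lZ hal hbe e1E' sT0 sT et0 e1t).
exists m, S; split=> //; first exact: leqW.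
move=> T t sT et; case: (pselect (act T e1 t = 0)) => [e1t|e1t].
  by apply: (aS T t sT); rewrite actBl e1t subr0.
apply: contrapT => nT; apply: noT; exists T, t; split=> // i lt_im TS.
by apply: nT; exists i.
Qed.

Lemma num_simples_local n : thrun (@local k A) n (\1%VF : 'End(modl B)) ->
  exists2 m, (m <= n)%N & num_simples E m.
Proof.
move=> tn; have [|m [S [le_mn sS nS aS]]] := simples_thrun (e := 1) tn.
  by move=> x; rewrite act1 id_lfunE.
exists m => //; apply: num_simples_seq sS nS _ => T sT.
have [_ T0 _] := sT.
have [t t0] : exists t : T, t <> 0.
  apply: contrapT => /forallNP nt; apply: T0; apply/eqP; rewrite -subv0.
  by apply/subvP => t _; rewrite memv0; apply/eqP; apply: contrapT; apply: nt.
by apply: (aS T t sT); rewrite act1.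
Qed.

End Simples.

(** * Rigidity dimension *)

Section Rigidity.
Context (k : fieldType) (A : falgType k).
Implicit Types (M N X Y : fdmod A).

Definition selfvan t M := van (fun _ => eq M) t M.

Lemma domdim_selfvan M (gcM : gen_cogen M) t :
  ele (Fin t.+2) (domdim (End_alg (gen_cogen_nonzero gcM))) <-> selfvan t M.
Proof.
have [/in_add_inadd gA /in_add_inadd gD] := gcM.
have := mueller (@full_endo _ _ _ (gen_cogen_nonzero gcM)) (@faithful_endo _ _ _ _).
rewrite modl_endo => /(_ gA gD t); apply: iff_trans; exact: domdimP.
Qed.

Lemma van_pair t M X Y : inadd (eq M) X -> inadd (eq M) Y -> selfvan t M ->
  van (fun _ => eq Y) t X.
Proof.
move=> aX aY vM; apply: van_add_target (_ : van (fun _ => eq M) t X).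
  by move=> s _ <-.
by apply: van_add; apply: inadd_sub aX => _ <-.
Qed.

(** If all local pairs vanish, [van_inter] collects the targets Y, [van_add_target] replaces them by
    M, and [van_add] replaces X by M. *)
Lemma van_local_pair t M : ~ selfvan t M -> exists X Y,
  [/\ local X, local Y, retract X M, retract Y M & ~ van (fun _ => eq Y) t X].
Proof.
move=> nv; apply: contrapT => nXY; apply: nv.
pose C Z := local Z /\ retract Z M.
apply: van_add; apply: inadd_sub (local_decomposition M) => X [lX rX].
pose T := {Y : fdmod A | C Y}.
have v : van (fun _ N => exists j : T, sval j = N) t X.
  apply: van_inter => -[Y [lY rY]] /=.
  by apply: contrapT => nv; apply: nXY; exists X, Y.
apply: van_add_target v => _ _ <-.
apply: inadd_sub (local_decomposition M) => Y CY.
by exists (exist _ Y CY).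
Qed.

(** Vanishing for all t pushes the dominant dimension above the bound [d] on projective dimensions,
    so all E-modules are projective and monomorphisms of A-modules split. *)
Lemma infinite_domdim_semisimple M (gcM : gen_cogen M) :
  efinite (gldim (End_alg (gen_cogen_nonzero gcM))) ->
  (forall t, selfvan t M) -> semisimple_alg A.
Proof.
move=> /gldim_pdle[d pd] vM.
have [/in_add_inadd gA /in_add_inadd gD] := gcM.
have allP (Y : fdmod (End_alg (gen_cogen_nonzero gcM))) : projective Y.
  apply: (dd_gldim_projective pd); apply: (dd_leq (leqnSn _)).
  exact/domdimP/domdim_selfvan/vM.
apply: semisimple_of_split => X Z j.
apply: (all_mono_split (B := endo_bimod (gen_cogen_nonzero gcM))) => //;
  rewrite ?modl_endo //; exact: full_endo.
Qed.

Lemma rigdim_infinite : ~ efinite (rigdim A) -> forall t,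
  exists M (gcM : gen_cogen M),
    efinite (gldim (End_alg (gen_cogen_nonzero gcM))) /\ selfvan t M.
Proof.
move=> inf t; apply: contrapT => noM; apply: inf; apply/esup_finiteP.
(* A dominant dimension above t+1 is at least t+2, which means vanishing up to t. *)
exists t.+1 => _ [M [gcM [gM ->]]]; apply: contrapT => nle.
apply: noM; exists M, gcM; split=> //; apply/domdim_selfvan.
by case: (domdim _) nle => //= n; rewrite leqNgt => /negP; rewrite negbK.
Qed.

Lemma retract_inadd X M : retract X M -> inadd (eq M) X.
Proof.
by move=> [i [p [hi hp pi]]]; apply: (inadd_retract hi hp pi); apply: inadd_self.
Qed.

Lemma TC1_rigdim : ~ self_injective A -> TC1 k -> efinite (rigdim A).
Proof.
move=> nsi tc; apply: contrapT => /rigdim_infinite inf; apply: nsi; apply: tc => i i0.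
apply: van_Ext_zero => // t; have [M [gcM [_ vM]]] := inf t.
have [/in_add_inadd gA /in_add_inadd gD] := gcM.
exact: van_pair gD gA vM.
Qed.

Lemma YC_rigdim : ~ semisimple_alg A -> YC k -> efinite (rigdim A).
Proof.
move=> nss [phi [_ yc]]; apply: contrapT => /rigdim_infinite inf.
have cnt (M : fdmod A) : exists n, thrun (@local k A) n (\1%VF : 'End(M)).
  by apply/thru_thrun; apply: inadd_sub (local_decomposition M) => X [].
have [a ta] := cnt (regular_mod A); have [b tb] := cnt (dual_mod A).
(* [phi] need not be monotone and the number of simples is only bounded above by a + b + 2, so the
   maximum over all arguments up to that bound is taken. It is fixed before M is chosen. *)
pose bound := (\max_(i < (a + b + 2).+1) phi i)%N.
have [M [gcM [gM vM]]] := inf bound.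
have [t nvt] : exists t, ~ selfvan t M.
  apply: contrapT => /forallNP all; apply: nss.
  apply: (infinite_domdim_semisimple gM) => t; apply: contrapT; exact: all.
have [X [Y [lX lY rX rY nXY]]] := van_local_pair nvt.
have [/in_add_inadd gA /in_add_inadd gD] := gcM.
(* N inherits the vanishing of M because it lies in add(M), and fails at t because X and Y lie in
   add(N); its count of local factors, a + b + 2, does not depend on M. *)
pose D := dsum_mod (regular_mod A) (dual_mod A).
pose N := dsum_mod D (dsum_mod X Y).
have aN : inadd (eq M) N.
  by do !apply: inadd_dsum => //; apply: retract_inadd.
have retr (U V : fdmod A) : retract U (dsum_mod U V) /\ retract V (dsum_mod U V).
  split; [exists (ds_in1 U V), (ds_pr1 U V)|exists (ds_in2 U V), (ds_pr2 U V)]; split.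
  - exact: hom_in1. - exact: hom_pr1. - exact: ds_pr1_in1.
  - exact: hom_in2. - exact: hom_pr2. - exact: ds_pr2_in2.
have rDN : retract D N by case: (retr D (dsum_mod X Y)).
have rXYN : retract (dsum_mod X Y) N by case: (retr D (dsum_mod X Y)).
have gcN : gen_cogen N.
  split.
    have [i [p [hi hp pi]]] := retract_trans (retr (regular_mod A) (dual_mod A)).1 rDN.
    exact: retract_in_add hi hp pi.
  have [i [p [hi hp pi]]] := retract_trans (retr (regular_mod A) (dual_mod A)).2 rDN.
  exact: retract_in_add hi hp pi.
have vN : selfvan bound N by apply: van_pair vM.
have nvN : ~ selfvan t N.
  move=> vt; apply: nXY; apply: van_pair vt; apply: retract_inadd.
    exact: retract_trans (retr X Y).1 rXYN.
  exact: retract_trans (retr X Y).2 rXYN.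
have t1 (Z : fdmod A) : local Z -> thrun (@local k A) 1 (\1%VF : 'End(Z)).
  move=> lZ; have := thrunS lZ (@hom_id _ _ Z) (@hom_id _ _ Z) (@thrun0 _ _ _ Z Z).
  by rewrite comp_lfun1l addr0.
have tN : thrun (@local k A) (a + b + 2) (\1%VF : 'End(N)).
  exact: (thrun_dsum (thrun_dsum ta tb) (thrun_dsum (t1 _ lX) (t1 _ lY))).
pose E := End_alg (gen_cogen_nonzero gcN).
have [m le_m nsE] : exists2 m, (m <= a + b + 2)%N & num_simples E m.
  apply: (num_simples_local (B := endo_bimod (gen_cogen_nonzero gcN))).
  - exact: full_endo.
  - exact: faithful_endo.
  - by rewrite modl_endo.
have ddE : ele (Fin bound.+2) (domdim E) by apply/domdim_selfvan.
have finE : efinite (domdim E).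
  case dE : (domdim E) => [//|]; case: nvN.
  by apply/(domdim_selfvan gcN); rewrite -/E dE.
(* The lower bound [bound] + 2 on the dominant dimension exceeds phi m, which is at most [bound]. *)
have := yc E m nsE finE; move: ddE; case: (domdim E) => //= d lt_d le_d.
have := leq_trans lt_d le_d; rewrite leqNgt => /negP; apply.
have le_m' : (m < (a + b + 2).+1)%N by [].
rewrite ltnS; apply: leqW.
exact: (leq_bigmax (F := fun i : 'I_(a + b + 2).+1 => phi i) (Ordinal le_m')).
Qed.

End Rigidity.

Theorem theorem3p8 (k : fieldType) (A : falgType k) :
  ~ semisimple_alg A ->
  (~ self_injective A -> TC1 k -> efinite (rigdim A)) /\
  (YC k -> efinite (rigdim A)).
Proof.
by move=> nss; split; [exact: TC1_rigdim|exact: YC_rigdim].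
Qed.
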